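(* Let $\gamma\ge 0$ and $\beta\in\mathbb{R}$ be such that $q:=\frac{\beta}{\gamma+1}>\frac12$. Let $F:\mathbb{R}\to\mathbb{R}$ be a continuous function satisfying at least one of the following two conditions: (i) for all $v\in\mathbb{R}$ and $\lambda>0$, $F(\lambda v)=\lambda^{\gamma}F(v)$; (ii) $|F|\le G$ for some nonnegative function $G:\mathbb{R}\to[0,+\infty)$ such that $G(\lambda v)=\lambda^{\gamma}G(v)$ for all $v\in\mathbb{R}$ and $\lambda>0$. If $\gamma\ge 1$, suppose furthermore that $vF(v)\ge 0$ for all $v\in\mathbb{R}$. Let $t_0>0$, $v_0>0$, $x_0\in\mathbb{R}$, let $(B_t)_{t\ge 0}$ be a standard one-dimensional Brownian motion, and let $(V_t,X_t)_{t\ge t_0}$ be the solution to $$\mathrm{d}V_t=\mathrm{d}B_t-t^{-\beta}F(V_t)\,\mathrm{d}t,\quad V_{t_0}=v_0,\qquad \mathrm{d}X_t=V_t\,\mathrm{d}t,\quad X_{t_0}=x_0 .$$ Let $(\mathcal{B}_t)_{t\ge 0}$ be a standard Brownian motion. Then, as $\varepsilon\to 0$, $$\left(\sqrt{\varepsilon}\,V_{t/\varepsilon},\ \varepsilon^{3/2}X_{t/\varepsilon}\right)_{t\ge \varepsilon t_0}\ \Longrightarrow\ \left(\mathcal{B}_t,\ \int_0^t\mathcal{B}_s\,\mathrm{d}s\right)_{t\ge 0},$$ where $\Longrightarrow$ denotes convergence in distribution in the space of continuous functions on $(0,+\infty)$ with the topology of uniform convergence on compact subsets.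
   Context: Under the stated assumptions the stochastic differential equation has a pathwise unique strong solution, which is almost surely defined for all $t\ge t_0$ (no explosion). Convergence in distribution $\Longrightarrow$ of a family of continuous processes, as $\varepsilon\to0$, is in $\mathcal{C}((0,+\infty),\mathbb{R})$ (here $\mathcal{C}((0,+\infty),\mathbb{R}^2)$, the product of two such path spaces, for the pair of processes), endowed with the distance $$\mathrm{d}_u(f,g)=\sum_{n=1}^{+\infty}\frac{1}{2^n}\min\Big(1,\sup_{[\frac1n,n]}|f-g|\Big).$$ The rescaled processes are defined for $t\ge\varepsilon t_0$; on $(0,\varepsilon t_0]$ they are extended by the constant equal to their value at $t=\varepsilon t_0$ (the choice of extension is immaterial for this topology as $\varepsilon\to0$). *)

(* Defs.v *)
From HB Require Import structures.
From mathcomp Require Import all_boot all_order all_algebra.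
From mathcomp Require Import lra.
From mathcomp Require Import all_classical all_reals all_analysis.

Set Implicit Arguments.
Unset Strict Implicit.
Unset Printing Implicit Defensive.
Import Order.TTheory GRing.Theory Num.Theory.
Import numFieldNormedType.Exports.
Local Open Scope classical_set_scope.
Local Open Scope ring_scope.

(** * The path space C((0, +oo), R)

    A path is represented by a total function on [R]; only its values on
    (0, +oo) are constrained, and the distance [d_u] below does not see the
    others.  Hence [d_u] is a pseudo-distance here, and a continuous functional
    on [cpath R] only depends on the restriction of the path to (0, +oo). *)
Record cpath (R : realType) := CPath {
  path_fun :> R -> R ;
  path_continuous : forall t, 0 < t -> {for t, continuous path_fun} }.

HB.instance Definition _ (R : realType) := gen_eqMixin (cpath R).
HB.instance Definition _ (R : realType) := gen_choiceMixin (cpath R).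

Section path_distance.
Context {R : realType}.
Implicit Types (f g h : cpath R) (n : nat).

Definition sup_dist n f g : R :=
  sup [set `|f t - g t| | t in `[n%:R^-1, n%:R]].

(** [series u] starts at index 0, hence the shift from [n] to [n.+1]. *)
Definition du_term f g n : R := 2 ^- n.+1 * Num.min 1 (sup_dist n.+1 f g).

Definition d_u f g : R := limn (series (du_term f g)).

Let invn_len n : n.+1%:R^-1 <= n.+1%:R :> R.
Proof. by apply: (@le_trans _ _ 1); rewrite ?invf_le1 ?ler1n. Qed.

Lemma sup_dist_has_ub n f g :
  has_ubound [set `|f t - g t| | t in `[n.+1%:R^-1, n.+1%:R]].
Proof.
have cfg : {within `[n.+1%:R^-1, n.+1%:R], continuous (fun t => `|f t - g t|)}.
  apply: continuous_in_subspaceT => t; rewrite inE/= in_itv/= => /andP[t0 _].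
  have {}t0 : 0 < t by rewrite (lt_le_trans _ t0)// invr_gt0.
  by apply: cvg_norm; apply: cvgB; exact: path_continuous.
have [c _ cM] := EVT_max (invn_len n) cfg.
by exists `|f c - g c| => _ [t tn <-]; apply: cM.
Qed.

Lemma le_sup_dist n f g t : n.+1%:R^-1 <= t <= n.+1%:R ->
  `|f t - g t| <= sup_dist n.+1 f g.
Proof.
move=> tn; apply: ub_le_sup; first exact: sup_dist_has_ub.
by exists t => //=; rewrite in_itv.
Qed.

Lemma sup_dist_le n f g M :
  (forall t, n.+1%:R^-1 <= t <= n.+1%:R -> `|f t - g t| <= M) ->
  sup_dist n.+1 f g <= M.
Proof.
move=> fgM; apply: ge_sup.
  exists `|f n.+1%:R - g n.+1%:R|; exists n.+1%:R => //=.
  by rewrite in_itv/= lexx (invn_len n).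
by move=> _ [t tn <-]; apply: fgM; move: tn; rewrite /= in_itv.
Qed.

Lemma sup_dist_ge0 n f g : 0 <= sup_dist n.+1 f g.
Proof.
apply: (le_trans _ (@le_sup_dist n f g n.+1%:R _)) => //.
by rewrite lexx (invn_len n).
Qed.

Lemma sup_distxx n f : sup_dist n.+1 f f = 0.
Proof.
apply/eqP; rewrite eq_le sup_dist_ge0 andbT.
by apply: sup_dist_le => t _; rewrite subrr normr0.
Qed.

Lemma sup_distC n f g : sup_dist n f g = sup_dist n g f.
Proof.
by rewrite /sup_dist; congr sup; apply: eq_imagel => t _; rewrite distrC.
Qed.

Lemma sup_dist_triangle n f g h :
  sup_dist n.+1 f h <= sup_dist n.+1 f g + sup_dist n.+1 g h.
Proof.
apply: sup_dist_le => t tn; rewrite (le_trans (ler_distD (g t) _ _))//.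
by rewrite lerD// le_sup_dist.
Qed.

Lemma du_term_ge0 f g n : 0 <= du_term f g n.
Proof. by rewrite mulr_ge0 ?invr_ge0 ?exprn_ge0// le_min ler01 sup_dist_ge0. Qed.

Lemma du_term_le f g n : du_term f g n <= geometric 2^-1 2^-1 n.
Proof.
by rewrite /geometric/= -exprS exprVn ler_piMr ?invr_ge0 ?exprn_ge0// ge_min lexx.
Qed.

Lemma is_cvg_du f g : cvgn (series (du_term f g)).
Proof.
apply: (@series_le_cvg _ _ (geometric 2^-1 2^-1)).
- exact: du_term_ge0.
- by move=> n; rewrite (le_trans _ (du_term_le f g n))// du_term_ge0.
- exact: du_term_le.
- by apply: is_cvg_geometric_series; rewrite ger0_norm ?invr_ge0// invf_lt1 ?ltr1n.
Qed.

Lemma d_uxx f : d_u f f = 0.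
Proof.
rewrite /d_u (_ : series _ = cst 0) ?lim_cst//; apply/funext => n.
rewrite /series/= big1// => i _.
by rewrite /du_term sup_distxx (min_idPr _) ?ler01// mulr0.
Qed.

Lemma d_uC f g : d_u f g = d_u g f.
Proof.
rewrite /d_u; congr (limn (series _)); apply/funext => n.
by rewrite /du_term sup_distC.
Qed.

Lemma d_u_triangle f g h : d_u f h <= d_u f g + d_u g h.
Proof.
rewrite /d_u -limD; [|exact: is_cvg_du|exact: is_cvg_du].
apply: ler_lim; [exact: is_cvg_du|by apply: is_cvgD; exact: is_cvg_du|].
apply: nearW => n; rewrite /series/= [leRHS](_ : _ =
  \sum_(0 <= k < n) (du_term f g k + du_term g h k)); last by rewrite big_split.
apply: ler_sum => k _; rewrite /du_term -mulrDr.
rewrite ler_pM2l ?invr_gt0 ?exprn_gt0//.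
have := sup_dist_triangle k f g h.
have := sup_dist_ge0 k f g; have := sup_dist_ge0 k g h.
rewrite !minEle; case: ifPn => a; case: ifPn => b; case: ifPn => c; lra.
Qed.

End path_distance.

Section path_pseudometric.
Context {R : realType}.
Implicit Types f g h : cpath R.

Let ball f (e : R) : set (cpath R) := [set g | d_u f g < e].
Let ent : set_system (cpath R * cpath R) := entourage_ ball.
Let nbhs f : set_system (cpath R) := nbhs_ ent f.
Let nbhsE : nbhs = nbhs_ ent. Proof. by []. Qed.

HB.instance Definition _ := hasNbhs.Build (cpath R) nbhs.

Let ball_center f (e : R) : 0 < e -> ball f e f.
Proof. by rewrite /ball/= d_uxx. Qed.

Let ball_sym f g (e : R) : ball f e g -> ball g e f.
Proof. by rewrite /ball/= d_uC. Qed.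

Let ball_triangle f g h e1 e2 :
  ball f e1 g -> ball g e2 h -> ball f (e1 + e2) h.
Proof.
by rewrite /ball/= => ? ?; rewrite (le_lt_trans (d_u_triangle f g h))// ltrD.
Qed.

Let entE : ent = entourage_ ball. Proof. by []. Qed.

HB.instance Definition _ := @Nbhs_isPseudoMetric.Build R (cpath R)
  ent nbhsE ball ball_center ball_sym ball_triangle entE.

End path_pseudometric.

Lemma cpath_ballE (R : realType) (f : cpath R) (e : R) :
  ball f e = [set g | d_u f g < e].
Proof. by []. Qed.

(** * Paths built from functions on a half-line *)
Section half_line.
Context {R : realType}.
Implicit Type f : R -> R.

Lemma rescaled_continuous (a t0 eps : R) f : {within `[t0, +oo[, continuous f} ->
  continuous (fun t : R => a * f (Num.max t0 (t / eps))).
Proof.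
move=> /subspace_continuousP cf t; apply: cvgM; first exact: cvg_cst.
have max_ge s : `[t0, +oo[%classic (Num.max t0 (s / eps)).
  by rewrite /= in_itv/= andbT le_max lexx.
have cm : {for t, continuous (fun s : R => Num.max t0 (s / eps))}.
  apply: (@continuous_max R R (cst t0) (fun s : R => s / eps) t); first exact: cvg_cst.
  by apply: cvgM; [exact: cvg_id|exact: cvg_cst].
move=> A /(cf _ (max_ge t)) /cm hA.
have : (nbhs t) [set s | A (f (Num.max t0 (s / eps)))].
  by apply: (@filterS _ (nbhs t) _ _ _ _ hA) => s; apply; exact: max_ge.
exact.
Qed.

(** The process [t |-> a * f (t / eps)], defined for [t >= eps * t0] and
    extended by its value at [eps * t0]. *)
Definition rescaled (a t0 eps : R) f (cf : {within `[t0, +oo[, continuous f}) :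
    cpath R :=
  CPath (fun t _ => @rescaled_continuous a t0 eps f cf t).

Lemma within0y_continuous f : {within `[0, +oo[, continuous f} ->
  forall t, 0 < t -> {for t, continuous f}.
Proof.
move=> cf t t0; apply: (@within_continuous_continuous R _ R 0 (t + 1) f t).
- by rewrite ltr_wpDl// ltW.
- apply: continuous_subspaceW cf => s /=.
  by rewrite !in_itv/= andbT => /andP[].
- by rewrite in_itv/= t0 ltrDl ltr01.
Qed.

Definition restricted f (cf : {within `[0, +oo[, continuous f}) : cpath R :=
  CPath (within0y_continuous cf).

Lemma integral_continuous f : {within `[0, +oo[, continuous f} ->
  forall t, 0 < t -> {for t, continuous (fun t : R =>
    \int[@lebesgue_measure R]_(s in `[0, t]) f s)}.
Proof.
move=> cf t t0; apply: (@within_continuous_continuous R _ R 0 (t + 1) _ t).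
- by rewrite ltr_wpDl// ltW.
- apply: parameterized_integral_continuous; first by rewrite ltW// ltr_wpDl// ltW.
  apply: continuous_compact_integrable; first exact: segment_compact.
  apply: continuous_subspaceW cf => s /=.
  by rewrite !in_itv/= andbT => /andP[].
- by rewrite in_itv/= t0 ltrDl ltr01.
Qed.

Definition integrated f (cf : {within `[0, +oo[, continuous f}) : cpath R :=
  CPath (integral_continuous cf).

End half_line.

(** * Convergence in distribution

    [Z e] (for [e] in the index set of the filter [F]) and [Y] may live on
    different probability spaces.  Measurability of [Phi \o Z e] is not part
    of the definition: it is automatic for path-valued maps whose evaluations at
    each time are random variables, since the Borel sets of the path space are
    generated by these evaluations. *)
Definition cvg_in_distribution {R : realType} {S : topologicalType}
    {I : Type} {d d' : measure_display}
    {T : measurableType d} (P : probability T R) (Z : I -> T -> S)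
    (F : set_system I)
    {T' : measurableType d'} (P' : probability T' R) (Y : T' -> S) : Prop :=
  forall Phi : S -> R, continuous Phi -> (exists M, forall s, `|Phi s| <= M) ->
    ('E_P[Phi \o Z e] @[e --> F] --> 'E_P'[Phi \o Y])%E.

(** * Brownian motion and the stochastic differential equation *)
Section processes.
Context {R : realType} {d : measure_display} {T : measurableType d}
  (P : probability T R).

(** Taking some [A i] equal to [setT] gives the product rule for every
    subfamily. *)
Definition mutually_independent n (X : 'I_n -> T -> R) : Prop :=
  forall A : 'I_n -> set R, (forall i, measurable (A i)) ->
    P (\bigcap_(i in [set: 'I_n]) (X i @^-1` A i)) =
    (\big[*%E/1%E]_(i < n) P (X i @^-1` A i))%E.

(** Time ranges over [R], but only nonnegative times are constrained.
    The second parameter of [normal_prob] is the standard deviation. *)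
Record brownian_motion (B : R -> {RV P >-> R}) : Prop := BrownianMotion {
  bm_start : {ae P, forall w, B 0 w = 0} ;
  bm_continuous : forall w, {within `[0, +oo[, continuous (fun t => B t w)} ;
  bm_gaussian : forall s t, 0 <= s -> s < t ->
    forall A, measurable A ->
      P ((B t \- B s) @^-1` A) = normal_prob 0 (Num.sqrt (t - s)) A ;
  bm_independent : forall n (t : nat -> R), 0 <= t 0%N ->
    {homo t : i j / (i <= j)%N >-> i <= j} ->
    mutually_independent (fun i : 'I_n => B (t i.+1) \- B (t i)) }.

(** The natural filtration of [B], completed by the negligible sets. *)
Definition augmented_filtration (B : R -> {RV P >-> R}) (t : R) : set (set T) :=
  <<s [set A | P.-negligible A \/
        exists s U, [/\ 0 <= s <= t, measurable U & A = B s @^-1` U]] >>.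

(** As the noise is additive, the equation for [V] in integral form involves no
    stochastic integral.  Continuity is required of every path and the equations
    almost surely; the equations hold simultaneously for all [t >= t0], so the
    solution does not explode. *)
Record strong_solution (F : R -> R) (beta t0 v0 x0 : R)
    (B V X : R -> {RV P >-> R}) : Prop := StrongSolution {
  sol_adapted : forall t U, t0 <= t -> measurable U ->
    augmented_filtration B t (V t @^-1` U) /\
    augmented_filtration B t (X t @^-1` U) ;
  sol_continuousV : forall w, {within `[t0, +oo[, continuous (fun t => V t w)} ;
  sol_continuousX : forall w, {within `[t0, +oo[, continuous (fun t => X t w)} ;
  sol_V : {ae P, forall w, forall t, t0 <= t ->
    V t w = v0 + (B t w - B t0 w) -
      \int[@lebesgue_measure R]_(s in `[t0, t]) (s `^ (- beta) * F (V s w))} ;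
  sol_X : {ae P, forall w, forall t, t0 <= t ->
    X t w = x0 + \int[@lebesgue_measure R]_(s in `[t0, t]) V s w} }.

End processes.

Arguments bm_continuous : clear implicits.
Arguments bm_continuous {R d T P B} _ _.
Arguments sol_continuousV : clear implicits.
Arguments sol_continuousV {R d T P F beta t0 v0 x0 B V X} _ _.
Arguments sol_continuousX : clear implicits.
Arguments sol_continuousX {R d T P F beta t0 v0 x0 B V X} _ _.

(** Homogeneity under positive scalings only. *)
Definition pos_homogeneous {R : realType} (gamma : R) (G : R -> R) : Prop :=
  forall v lambda, 0 < lambda -> G (lambda * v) = lambda `^ gamma * G v.

(* Main.v *)
Require Import Defs.
From HB Require Import structures.
From mathcomp Require Import all_boot all_order all_algebra.
From mathcomp Require Import lra ring.
From mathcomp Require Import all_classical all_reals all_analysis.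
From mathcomp Require Import measurable_realfun.

Set Implicit Arguments.
Unset Strict Implicit.
Unset Printing Implicit Defensive.
Import Order.TTheory GRing.Theory Num.Theory.
Import numFieldNormedType.Exports.
Local Open Scope classical_set_scope.
Local Open Scope ring_scope.

(** For [beta > (gamma + 1) / 2] the drift is of smaller order than the noise.
    Almost surely [B t] is at most of order [t `^ p] for every [p > 1/2]
    ([brownian_growth], by chaining over dyadic increments). This growth passes
    to the solution: if [gamma >= 1] the drift points towards the origin, so that
    since its last passage near the origin [V] has moved at most as far as the
    noise; if [gamma < 1] the drift is sublinear in [V]. As
    [`|F v| <= K * `|v| `^ gamma], the integrated drift is then at most a multiple
    of the integral of [s `^ (gamma * p - beta)], and for [p] close to [1/2] the
    condition on [beta] makes this integral of order [t `^ r] for some [r < 1/2].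
    Hence [V t - B t] is of order [t `^ r] ([solution_noise_close]), and

      [Num.sqrt eps * (V (t / eps) - B (t / eps))],
      [eps `^ (3 / 2) * (X (t / eps) - \int_0^(t / eps) B)]

    are both of order [eps `^ (1/2 - r)], uniformly on compact subsets of
    (0, +oo): the rescaled solution merges almost surely with the pair made of
    the path [Num.sqrt eps * B (t / eps)] and its primitive.

    The law of this last pair does not depend on [eps]. Indeed
    [Num.sqrt eps * B (t / eps)] is again a Brownian motion
    ([brownian_motion_rescale]), and the axioms of Brownian motion determine the
    law of a path together with its primitive ([brownian_motion_law]). For the
    latter, a path is approximated by the piecewise linear one built on its
    increments over a grid, rounded to a lattice. The approximation takes
    countably many values, with probabilities given by the independence and the
    normality of the increments. Continuous functionals of the path are limits
    of functions of such discrete data, which gives their measurability and the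
    equality of their expectations.

    Finally, families that merge almost surely have the same limits in law
    ([merging_law]). *)

(** * Integrals of continuous functions *)

Section continuous_integrals.
Context {R : realType}.
Implicit Types (f g : R -> R) (a b c e : R).
Notation mu := (@lebesgue_measure R).

Lemma within_itv_sub f a b a' b' : a' <= a -> b <= b' ->
  {within `[a', b'], continuous f} -> {within `[a, b], continuous f}.
Proof.
move=> aa bb; apply: continuous_subspaceW => s /=.
by rewrite !in_itv/= => /andP[? ?]; apply/andP; split; lra.
Qed.

Lemma within_ray_sub f a b t0 : t0 <= a ->
  {within `[t0, +oo[, continuous f} -> {within `[a, b], continuous f}.
Proof.
move=> ta; apply: continuous_subspaceW => s /=.
by rewrite !in_itv/= andbT => /andP[? ?]; lra.
Qed.

Lemma dilation_continuous f (eps : R) : 0 < eps -> {within `[0, +oo[, continuous f} ->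
  {within `[0, +oo[, continuous (fun s => f (s / eps))}.
Proof.
move=> e0 /subspace_continuousP cf; apply/subspace_continuousP => t t0 /=.
have ray u : (`[0, +oo[%classic : set R) u -> (`[0, +oo[%classic : set R) (u / eps).
  by rewrite /= !in_itv/= !andbT => u0; rewrite divr_ge0// ltW.
apply: (@cvg_comp _ _ _ (fun u => u / eps) f (within `[0, +oo[ (nbhs t))
  (within `[0, +oo[ (nbhs (t / eps)))); last first.
  by have := cf (t / eps) (ray _ t0); apply.
have c1 : {for t, continuous (fun u : R => u / eps)}.
  by apply: cvgM; [exact: cvg_id|exact: cvg_cst].
move=> U hU; apply: (@filterS _ (nbhs t) _ _ _ _ (c1 _ hU)) => u hu u0.
exact: (hu (ray _ u0)).
Qed.

Lemma segment_integrable f a b : {within `[a, b], continuous f} ->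
  mu.-integrable `[a, b] (EFin \o f).
Proof. by apply: continuous_compact_integrable; exact: segment_compact. Qed.

Lemma Rintegral_split f a b c : a <= b -> b <= c ->
  {within `[a, c], continuous f} ->
  \int[mu]_(s in `[a, c]) f s = \int[mu]_(s in `[a, b]) f s + \int[mu]_(s in `[b, c]) f s.
Proof.
move=> ab bc cf; rewrite -[X in _ + X]Rintegral_itv_obnd_cbnd.
  rewrite -(@Rintegral_itvB _ f (BLeft a) (BRight c) b);
    [by rewrite addrC subrK|exact: segment_integrable| |].
  - by rewrite bnd_simp.
  - by rewrite bnd_simp.
apply: integrableS (segment_integrable (within_itv_sub ab (lexx c) cf)) => //.
by move=> s /=; rewrite !in_itv/= => /andP[/ltW -> ->].
Qed.

Lemma Rintegral_segment_cst a b c : a <= b -> \int[mu]_(s in `[a, b]) c = c * (b - a).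
Proof.
move=> ab; rewrite Rintegral_cst//= lebesgue_measure_itv/= lte_fin.
by case: ltgtP ab => // -> _; rewrite subrr.
Qed.

Lemma le_abs_Rintegral f g a b :
  {within `[a, b], continuous f} -> {within `[a, b], continuous g} ->
  (forall s, a <= s <= b -> `|f s| <= g s) ->
  `|\int[mu]_(s in `[a, b]) f s| <= \int[mu]_(s in `[a, b]) g s.
Proof.
move=> cf cg fg; apply: le_trans (le_normr_Rintegral _ (segment_integrable cf)) _ => //.
have cnf : {within `[a, b], continuous (fun x => `|f x|)}.
  by move=> x; apply: cvg_norm; exact: cf.
apply: (le_Rintegral _ (segment_integrable cnf) (segment_integrable cg)) => //.
Qed.

Lemma Rintegral_dist_le f g a b e : a <= b ->
  {within `[a, b], continuous f} -> {within `[a, b], continuous g} ->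
  (forall s, a <= s <= b -> `|f s - g s| <= e) ->
  `|\int[mu]_(s in `[a, b]) f s - \int[mu]_(s in `[a, b]) g s| <= e * (b - a).
Proof.
move=> ab cf cg fg; rewrite -Rintegral_segment_cst//.
rewrite -RintegralB//; [|exact: segment_integrable..].
apply: le_abs_Rintegral => // x; last exact: cvg_cst.
by apply: cvgB; [exact: cf|exact: cg].
Qed.

(** Heine's theorem: by compactness it suffices that [f] oscillates by less than
    [e] near each point of the segment. *)
Lemma uniform_continuity f a b : {within `[a, b], continuous f} ->
  forall e, 0 < e -> exists2 d, 0 < d & forall s t, a <= s <= b -> a <= t <= b ->
    `|s - t| < d -> `|f s - f t| <= e.
Proof.
move=> cf e e0.
have /compact_near_coveringP/(_ R 0^'+ (fun d t => forall s, a <= s <= b ->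
  a <= t <= b -> `|s - t| < d -> `|f s - f t| <= e)) := @segment_compact R a b.
have h x : `[a, b]%classic x -> \forall x' \near x & i \near 0^'+,
  forall s, a <= s <= b -> a <= x' <= b -> `|s - x'| < i -> `|f s - f x'| <= e.
  move=> xab; move/subspace_continuousP : cf => /(_ x xab).
  have e2 : 0 < e / 2 by rewrite divr_gt0.
  move=> /cvgrPdist_lt/(_ _ e2); rewrite near_withinE => -[r /= r0 hr].
  have hr' s : a <= s <= b -> `|x - s| < r -> `|f x - f s| < e / 2.
    by move=> sab xs; apply: hr => //=; rewrite in_itv.
  exists (ball x (r / 2), [set d | d < r / 2]).
    split; first by apply: nbhsx_ballx; rewrite divr_gt0.
    by near=> d; rewrite /=; near: d; apply: nbhs_right_lt; rewrite divr_gt0.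
  move=> [x' d] /= [xx' dr] s sab x'ab sx'.
  rewrite /ball/= in xx'.
  have h1 : `|f x - f x'| < e / 2 by apply: hr' => //; lra.
  have h2 : `|f x - f s| < e / 2.
    apply: hr' => //; have := ler_normD (x - x') (x' - s).
    by rewrite addrA subrK (distrC x' s); lra.
  have := ler_normD (f s - f x) (f x - f x').
  by rewrite addrA subrK (distrC (f s) (f x)); lra.
move=> /(_ _ h) hd.
have [d d0 hd'] : exists2 d, 0 < d & `[a, b]%classic `<=` (fun t => forall s, a <= s <= b ->
  a <= t <= b -> `|s - t| < d -> `|f s - f t| <= e).
  near (0 : R)^'+ => d; exists d; first by near: d; exact: nbhs_right_gt.
  by near: d; exact: hd.
exists d => // s t sab tab st; apply: (hd' t) => //=.
Unshelve. all: by end_near. Qed.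

End continuous_integrals.


(** * Convergence in the path space *)

Section path_convergence.
Context {R : realType}.
Implicit Types f g : cpath R.

Lemma d_u_le f g (e : R) N : 0 <= e ->
  (forall t, N.+1%:R^-1 <= t <= N.+1%:R -> `|f t - g t| <= e) ->
  d_u f g <= e + 2 ^- N.+1.
Proof.
move=> e0 fge.
have head K : (K <= N.+1)%N -> \sum_(0 <= k < K) du_term f g k <= e * (1 - 2 ^- K).
  elim: K => [|K IH] KN; first by rewrite big_nil expr0 invr1 subrr mulr0.
  rewrite big_nat_recr//= (le_trans (lerD (IH (ltnW KN)) (_ : _ <= 2 ^- K.+1 * e)))//.
    rewrite /du_term ler_pM2l ?invr_gt0 ?exprn_gt0// ge_min; apply/orP; right.
    apply: sup_dist_le => t /andP[t1 t2]; apply: fge; apply/andP; split.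
      by rewrite (le_trans _ t1)// lef_pV2 ?posrE// ler_nat.
    by rewrite (le_trans t2)// ler_nat.
  by rewrite exprSr invfM; lra.
have tail j : \sum_(0 <= k < N.+1 + j) du_term f g k <=
    e * (1 - 2 ^- N.+1) + 2 ^- N.+1 * (1 - 2 ^- j).
  elim: j => [|j IH]; first by rewrite addn0 expr0 invr1 subrr mulr0 addr0 head.
  rewrite addnS big_nat_recr//= (le_trans (lerD IH (du_term_le f g _)))//.
  have -> : geometric 2^-1 2^-1 (N.+1 + j) = 2 ^- N.+1 * 2 ^- j.+1 :> R.
    by rewrite /geometric/= -exprS -addnS exprD !exprVn.
  have -> : 2 ^- j = 2 * 2 ^- j.+1 :> R by rewrite exprSr invfM; lra.
  lra.
rewrite /d_u; apply: limr_le; first exact: is_cvg_du.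
near=> n; rewrite /series/=.
have Nn : (N.+1 <= n)%N by near: n; exact: nbhs_infty_ge.
rewrite -(subnKC Nn) (le_trans (tail _))//.
have p m : 0 < 2 ^- m :> R by rewrite invr_gt0 exprn_gt0.
by have := p N.+1; have := p (n - N.+1)%N; nra.
Unshelve. all: by end_near. Qed.

(** The tail of the series defining [d_u] is small whatever the paths, so only
    finitely many of its suprema matter. *)
Lemma d_u_cvg0 {I : Type} (D : set_system I) {FD : Filter D} (f_ g_ : I -> cpath R) :
  (forall (N : nat) (e : R), 0 < e -> \forall i \near D,
     forall t, N.+1%:R^-1 <= t <= N.+1%:R -> `|f_ i t - g_ i t| <= e) ->
  forall e : R, 0 < e -> \forall i \near D, d_u (f_ i) (g_ i) < e.
Proof.
move=> fg e e0.
have [N Ne] : exists N, 2 ^- N.+1 < e / 2 :> R.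
  have : (@GRing.exp R 2^-1) n @[n --> \oo] --> 0.
    by apply: cvg_expr; rewrite ger0_norm ?invr_ge0// invf_lt1 ?ltr1n.
  move=> /cvgr0Pnorm_lt /(_ _ (divr_gt0 e0 (@ltr0n R 2)))[N _ /(_ N.+1)].
  by rewrite /= leqnSn => /(_ isT) h; exists N; rewrite -exprVn (le_lt_trans (ler_norm _)).
near=> i; apply: (@le_lt_trans _ _ (e / 2 + 2 ^- N.+1)); last by lra.
apply: d_u_le; first by rewrite divr_ge0// ltW.
by near: i; apply: fg; rewrite divr_gt0.
Unshelve. all: by end_near. Qed.

Lemma cpath_cvg {I : Type} (D : set_system I) {FD : Filter D} (f_ : I -> cpath R) f :
  (forall (N : nat) (e : R), 0 < e -> \forall i \near D,
     forall t, N.+1%:R^-1 <= t <= N.+1%:R -> `|f_ i t - f t| <= e) ->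
  f_ i @[i --> D] --> f.
Proof.
move=> h; apply/cvg_ballP => e e0; rewrite near_map.
have := @d_u_cvg0 I D FD f_ (fun=> f) h e e0.
by apply: filterS => i; rewrite cpath_ballE/= d_uC.
Qed.

End path_convergence.

(** * Interpolation of paths from rounded increments *)

Section interpolation.
Context {R : realType}.
Implicit Types (f : R -> R) (a t e : R) (x : nat -> R).

Definition clamp (t : R) : R := Num.max 0 (Num.min 1 t).

(** The piecewise linear function with value [a] at [0] and increment [x i]
    over the [i]-th of the [n.+1 ^ 2] intervals of length [1 / n.+1] below
    [n.+1]. Written as a sum over increments, it is visibly continuous, and its
    coefficients are independent when the function interpolated is a Brownian
    path. *)
Definition interp n a x t : R :=
  a + \sum_(0 <= i < n.+1 ^ 2) x i * clamp (n.+1%:R * t - i%:R).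

Lemma clamp_ge0 t : 0 <= clamp t.
Proof. by rewrite /clamp le_max lexx. Qed.

Lemma clamp_le1 t : clamp t <= 1.
Proof. by rewrite /clamp ge_max ler01 ge_min lexx. Qed.

Lemma interp_continuous n a x : continuous (interp n a x).
Proof.
move=> t; apply: cvgD; first exact: cvg_cst.
elim: (n.+1 ^ 2)%N => [|m IH].
  have -> : (fun u => \sum_(0 <= i < 0) x i * clamp (n.+1%:R * u - i%:R)) = cst 0.
    by apply/funext => u; rewrite big_nil.
  by rewrite big_nil; exact: cvg_cst.
have -> : (fun u => \sum_(0 <= i < m.+1) x i * clamp (n.+1%:R * u - i%:R)) =
  (fun u => \sum_(0 <= i < m) x i * clamp (n.+1%:R * u - i%:R)) \+
  (fun u => x m * clamp (n.+1%:R * u - m%:R)).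
  by apply/funext => u; rewrite big_nat_recr.
rewrite big_nat_recr//=; apply: cvgD; first exact: IH.
apply: cvgM; first exact: cvg_cst.
have c1 : {for t, continuous (fun u : R => n.+1%:R * u - m%:R)}.
  by apply: cvgB; [apply: cvgM; [exact: cvg_cst|exact: cvg_id]|exact: cvg_cst].
apply: (@continuous_max R R (cst 0) (fun u => Num.min 1 (n.+1%:R * u - m%:R)) t).
  exact: cvg_cst.
by apply: (@continuous_min R R (cst 1) _ t) => //; exact: cvg_cst.
Qed.

Lemma interp_dist n a b x y e t : `|a - b| <= e -> (forall i, `|x i - y i| <= e) ->
  `|interp n a x t - interp n b y t| <= e * (1 + (n.+1 ^ 2)%:R).
Proof.
move=> ab xy; rewrite /interp opprD addrACA -sumrB mulrDr mulr1.
rewrite (le_trans (ler_normD _ _))// lerD//.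
rewrite (le_trans (ler_norm_sum _ _ _))//.
rewrite (@le_trans _ _ (\sum_(0 <= i < n.+1 ^ 2) e))//; last first.
  by rewrite big_const_nat iter_addr_0 subn0 mulr_natr.
apply: ler_sum => i _; rewrite -mulrBl normrM (ger0_norm (clamp_ge0 _)).
by rewrite (le_trans _ (xy i))// ler_piMr// clamp_le1.
Qed.

(** The clamped terms before the [j]-th are [1] and telescope; those after it
    vanish. *)
Lemma interp_grid n f j t : (j < n.+1 ^ 2)%N -> j%:R <= n.+1%:R * t <= j.+1%:R ->
  interp n (f 0) (fun i => f (i.+1%:R / n.+1%:R) - f (i%:R / n.+1%:R)) t =
  f (j%:R / n.+1%:R) +
    (f (j.+1%:R / n.+1%:R) - f (j%:R / n.+1%:R)) * (n.+1%:R * t - j%:R).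
Proof.
move=> jn /andP[jt tj]; rewrite /interp (@big_cat_nat _ _ _ j) ?(ltnW jn)//=.
rewrite addrA; congr (_ + _); last first.
  rewrite big_ltn// big_nat big1 ?addr0 => [|i /andP[ji _]].
    rewrite /clamp; congr (_ * _).
    rewrite (min_idPr _) ?(max_idPr _)//; first by rewrite subr_ge0.
    by rewrite lerBlDr addrC natr1.
  rewrite /clamp (min_idPr _) ?(max_idPl _) ?mulr0//.
    by rewrite subr_le0 (le_trans tj)// ler_nat.
  have : j.+1%:R <= i%:R :> R by rewrite ler_nat.
  lra.
rewrite (_ : \sum_(0 <= i < j) _ = \sum_(0 <= i < j)
    (f (i.+1%:R / n.+1%:R) - f (i%:R / n.+1%:R))).
  by rewrite telescope_sumr// mul0r addrC subrK.
apply: eq_big_nat => i /andP[_ ij].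
have : i.+1%:R <= j%:R :> R by rewrite ler_nat.
rewrite -natr1 => ?; rewrite /clamp (min_idPl _) ?(max_idPr _) ?mulr1//.
lra.
Qed.

Lemma interp_close n f T e t : T + 1 <= n.+1%:R -> 0 <= t <= T ->
  (forall s u, 0 <= s <= T + 1 -> 0 <= u <= T + 1 -> `|s - u| <= n.+1%:R^-1 ->
    `|f s - f u| <= e) ->
  `|interp n (f 0) (fun i => f (i.+1%:R / n.+1%:R) - f (i%:R / n.+1%:R)) t - f t| <= e.
Proof.
move=> Tn /andP[t0 tT] fe.
have n0 : 0 < n.+1%:R :> R by rewrite ltr0n.
have ninv : n.+1%:R^-1 <= 1 :> R by rewrite invf_le1// ler1n.
have ninv0 : 0 < n.+1%:R^-1 :> R by rewrite invr_gt0.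
have nt0 : 0 <= n.+1%:R * t by rewrite mulr_ge0// ltW.
have /andP[] := truncn_itv nt0; set j := Num.truncn _ => jt tj.
have jn : (j < n.+1 ^ 2)%N.
  rewrite -(ltr_nat R) (le_lt_trans jt)// natrX expr2 ltr_pM2l//; lra.
rewrite (@interp_grid _ _ j)//; last by rewrite jt ltW.
have h1 : `|f (j%:R / n.+1%:R) - f t| <= e.
  have j1 : j%:R / n.+1%:R <= t by rewrite ler_pdivrMr// mulrC.
  have j2 : t <= j%:R / n.+1%:R + n.+1%:R^-1.
    by rewrite -[X in _ + X]mul1r -mulrDl natr1 ler_pdivlMr// mulrC ltW.
  have j3 : 0 <= j%:R / n.+1%:R :> R by rewrite divr_ge0.
  by apply: fe; rewrite ?ler_norml; move: j1 j2 j3 ninv ninv0;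
    move: (n.+1%:R^-1) (j%:R / n.+1%:R) => m q *; apply/andP; split; lra.
have h2 : `|f (j.+1%:R / n.+1%:R) - f t| <= e.
  have j1 : j.+1%:R / n.+1%:R <= t + n.+1%:R^-1.
    by rewrite -natr1 mulrDl mul1r lerD2r ler_pdivrMr// mulrC.
  have j2 : t <= j.+1%:R / n.+1%:R by rewrite ler_pdivlMr// mulrC ltW.
  by apply: fe; rewrite ?ler_norml; move: j1 j2 ninv ninv0;
    move: (n.+1%:R^-1) (j.+1%:R / n.+1%:R) => m q *; apply/andP; split; lra.
rewrite -natr1 in tj.
set s := n.+1%:R * t - j%:R.
have s0 : 0 <= s by rewrite /s; lra.
have s1 : s <= 1 by rewrite /s; lra.
rewrite (_ : _ - f t = (1 - s) * (f (j%:R / n.+1%:R) - f t) +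
  s * (f (j.+1%:R / n.+1%:R) - f t)); last by ring.
rewrite (le_trans (ler_normD _ _))// !normrM (ger0_norm s0) ger0_norm; last by lra.
nra.
Qed.

(** Values and increments of a path, rounded down to multiples of
    [n.+1 ^- 3]: this mesh is fine enough for the [n.+1 ^ 2] rounding errors
    to add up to less than [2 / n.+1]. *)
Definition round n (u : R) : int := Num.floor ((n.+1 ^ 3)%:R * u).

Definition unround n (z : int) : R := z%:~R / (n.+1 ^ 3)%:R.

Definition codes n f (i : nat) : int :=
  if i is j.+1 then round n (f (j.+1%:R / n.+1%:R) - f (j%:R / n.+1%:R))
  else round n (f 0).

Definition codes_path n (c : nat -> int) : R -> R :=
  interp n (unround n (c 0%N)) (fun i => unround n (c i.+1)).

Lemma codes_path_continuous n c : continuous (codes_path n c).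
Proof. exact: interp_continuous. Qed.

Lemma unround_close n u : `|unround n (round n u) - u| <= (n.+1 ^ 3)%:R^-1.
Proof.
have k0 : 0 < (n.+1 ^ 3)%:R :> R by rewrite ltr0n expn_gt0.
rewrite /unround /round; set k := (n.+1 ^ 3)%:R in k0 *.
have /andP[h1 h2] := floor_itv (k * u).
rewrite intrD in h2.
rewrite -[X in _ - X](mulKf (lt0r_neq0 k0)) mulrC -mulrBr normrM gtr0_norm ?invr_gt0//.
rewrite ler_piMr ?invr_ge0 ?ltW// ltr_norml; apply/andP; split; lra.
Qed.

Lemma codes_path_close f (T e : R) : {within `[0, +oo[, continuous f} -> 0 < e ->
  \forall n \near \oo, forall t, 0 <= t <= T -> `|codes_path n (codes n f) t - f t| <= e.
Proof.
move=> cf e0.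
have [d d0 hd] := uniform_continuity (within_ray_sub (b := T + 1) (lexx 0) cf)
  (divr_gt0 e0 (ltr0n R 2)).
have /cvgr0Pnorm_lt hn : @harmonic R n @[n --> \oo] --> 0 by exact: cvg_harmonic.
near=> n => t tT.
have n0 : 0 < n.+1%:R :> R by rewrite ltr0n.
have ninv : n.+1%:R^-1 <= 1 :> R by rewrite invf_le1// ler1n.
have nd : n.+1%:R^-1 < d.
  by rewrite (le_lt_trans (ler_norm _))//; near: n; exact: hn.
have ne : n.+1%:R^-1 < e / 4.
  by rewrite (le_lt_trans (ler_norm _))//; near: n; apply: hn; rewrite divr_gt0.
have nT : T + 1 <= n.+1%:R.
  by rewrite -natr1 ler_wpDr//; near: n; exact: nbhs_infty_ger.
set g := interp n (f 0) (fun i => f (i.+1%:R / n.+1%:R) - f (i%:R / n.+1%:R)).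
have h1 : `|g t - f t| <= e / 2.
  apply: (@interp_close n f T) => // s u sT uT su; apply: hd => //.
  exact: le_lt_trans su nd.
have h2 : `|codes_path n (codes n f) t - g t| <= e / 2.
  rewrite (le_trans (@interp_dist n _ _ _ _ ((n.+1 ^ 3)%:R^-1) t _ _))//.
  - exact: unround_close.
  - by move=> i; exact: unround_close.
  rewrite !natrX; set m := n.+1%:R^-1 in ninv nd ne *.
  rewrite (_ : (n.+1%:R ^+ 3)^-1 * (1 + n.+1%:R ^+ 2) = m ^+ 3 + m); last first.
    by rewrite /m; field; rewrite lt0r_neq0.
  have m0 : 0 < m by rewrite invr_gt0.
  nra.
have := ler_normD (codes_path n (codes n f) t - g t) (g t - f t).
by rewrite addrA subrK; lra.
Unshelve. all: by end_near. Qed.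

End interpolation.

(** * Expectations of limits of countably valued maps *)

Section countable_approximation.
Context {R : realType}.

Lemma eq_measure_nat (m1 m2 : {measure set nat -> \bar R}) :
  (forall k, m1 [set k] = m2 [set k]) -> forall A, m1 A = m2 A.
Proof.
move=> m12 A; have -> : A = \bigcup_(k in A) [set k].
  by apply/seteqP; split => [k Ak|k [_ Aj ->]//]; exists k.
have tA : trivIset A (fun k => [set k]).
  by move=> i j _ _ [k [/= -> ->]].
by rewrite !measure_bigcup//; apply: eq_eseriesr => k _; exact: m12.
Qed.

Definition countable_valued {d} {T : measurableType d} {C : countType} (D : T -> C) :=
  forall c, measurable (D @^-1` [set c]).

Lemma countable_valued_measurable {d} {T : measurableType d} {C : countType} (D : T -> C)
    d' (Y : measurableType d') (h : C -> Y) :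
  countable_valued D -> measurable_fun [set: T] (h \o D).
Proof.
move=> mD _ A mA; rewrite setTI.
have -> : (h \o D) @^-1` A =
    \bigcup_(k in [set k | exists2 c, pickle c = k & A (h c)])
      \bigcup_(c in [set c | pickle c = k]) D @^-1` [set c].
  apply/seteqP; split => [w hw|w [_ [c <- Ahc]] [c' /=]].
    by exists (pickle (D w)); [exists (D w)|exists (D w)].
  by move=> /(pcan_inj pickleK) -> Dc /=; rewrite Dc.
apply: bigcup_measurable => k [c ck _].
rewrite (_ : [set c0 | _] = [set c]) ?bigcup_set1//.
by apply/seteqP; split=> [c' /=|c' /= ->//]; rewrite -ck => /(pcan_inj pickleK).
Qed.

Lemma bounded_integrable {d} {T : measurableType d} (P : probability T R) (f : T -> R) (M : R) :
  measurable_fun [set: T] f -> (forall w, `|f w| <= M) ->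
  P.-integrable [set: T] (EFin \o f).
Proof.
move=> mf fM; apply: measurable_bounded_integrable => //.
  by rewrite [X in (X < _)%E](_ : _ = 1%E) ?ltry//; exact: probability_setT.
exists M; split; first exact: num_real.
by move=> N MN w _ /=; rewrite (le_trans (fM w))// ltW.
Qed.

Lemma countable_valued_expectation {d} {T : measurableType d} (P : probability T R)
    {d'} {T' : measurableType d'} (P' : probability T' R) (C : countType)
    (D : T -> C) (D' : T' -> C) (h : C -> R) (M : R) :
  countable_valued D -> countable_valued D' ->
  (forall c, P (D @^-1` [set c]) = P' (D' @^-1` [set c])) ->
  (forall c, `|h c| <= M) ->
  ('E_P[h \o D] = 'E_P'[h \o D'])%E.
Proof.
move=> mD mD' PD hM.
pose g (k : nat) : \bar R := (odflt 0 (omap h (unpickle k)))%:E.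
have gK c : g (pickle c) = (h c)%:E by rewrite /g pickleK.
have law d0 (T0 : measurableType d0) (P0 : probability T0 R) (D0 : T0 -> C) :
    countable_valued D0 -> exists m : {measure set nat -> \bar R},
    (forall A, m A = P0 ((pickle \o D0) @^-1` A)) /\
    ('E_P0[h \o D0] = \int[m]_k g k)%E.
  move=> mD0.
  have mp : measurable_fun [set: T0] (pickle \o D0 : T0 -> nat).
    exact: countable_valued_measurable.
  pose X : {RV P0 >-> nat} :=
    MeasurableFun.Pack (MeasurableFun.Class (isMeasurableFun.Build _ _ _ _ _ mp)).
  exists (distribution P0 X); split => //.
  have -> : (\int[distribution P0 X]_k g k = \int[P0]_w (g \o X) w)%E.
    apply: integral_distribution => //.
    rewrite (_ : g \o X = EFin \o (h \o D0)); last first.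
      by apply/funext => w; rewrite /= gK.
    apply: (@bounded_integrable _ _ _ _ M) => [|w]; last exact: hM.
    exact: countable_valued_measurable.
  by rewrite unlock; apply: eq_integral => w _; rewrite /= gK.
have [m [mE ->]] := law _ _ P D mD.
have [m' [mE' ->]] := law _ _ P' D' mD'.
apply: eq_measure_integral => A _ _; apply: eq_measure_nat => k.
rewrite mE mE'.
case: (pselect (exists c : C, pickle c = k)) => [[c <-]|nk].
  have e d0 (T0 : measurableType d0) (D0 : T0 -> C) :
      (pickle \o D0) @^-1` [set pickle c] = D0 @^-1` [set c].
    by apply/seteqP; split => [w /(pcan_inj pickleK)|w /= ->].
  by rewrite !e PD.
have e d0 (T0 : measurableType d0) (D0 : T0 -> C) : (pickle \o D0) @^-1` [set k] = set0.
  by apply/seteqP; split => [w /= wk|//]; apply: nk; exists (D0 w).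
by rewrite !e !measure0.
Qed.

(** Continuous functionals of a map into a topological space are measurable as
    soon as the map is a pointwise limit of countably valued ones; no
    sigma-algebra on the target is involved. *)
Lemma countable_limit_expectation {d} {T : measurableType d} (P : probability T R)
    (S : topologicalType) (C : nat -> countType) (D : forall n, T -> C n)
    (p : forall n, C n -> S) (Z : T -> S) (Phi : S -> R) (M : R) :
  (forall n, countable_valued (D n)) ->
  (forall w, p n (D n w) @[n --> \oo] --> Z w) ->
  continuous Phi -> (forall s, `|Phi s| <= M) ->
  measurable_fun [set: T] (Phi \o Z) /\
  ('E_P[(Phi \o p n) \o D n] @[n --> \oo] --> 'E_P[Phi \o Z])%E.
Proof.
move=> mD pZ cPhi PhiM.
have mf n : measurable_fun [set: T] ((Phi \o p n) \o D n).
  exact: countable_valued_measurable.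
have cvZ w : Phi (p n (D n w)) @[n --> \oo] --> Phi (Z w).
  by apply: (cvg_comp _ _ (pZ w)); exact: cPhi.
have mZ : measurable_fun [set: T] (Phi \o Z).
  apply/measurable_EFinP.
  apply: (@emeasurable_fun_cvg _ _ _ _ (fun n => EFin \o ((Phi \o p n) \o D n))).
    by move=> n; apply/measurable_EFinP.
  by move=> w _; apply: cvg_EFin; [exact: nearW|exact: cvZ].
split => //.
have [|||||_ _] := @dominated_convergence _ T R P setT measurableT
  (fun n => EFin \o ((Phi \o p n) \o D n)) (EFin \o (Phi \o Z)) (cst M%:E).
- by move=> n; apply/measurable_EFinP.
- by apply/measurable_EFinP.
- apply: aeW => w _; apply: cvg_EFin; first exact: nearW.
  exact: cvZ.
- apply: (@bounded_integrable _ _ _ (cst M) `|M|) => //.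
- by apply: aeW => w n _; rewrite /= lee_fin.
by rewrite unlock.
Qed.

End countable_approximation.

(** * The law of a Brownian path and its primitive *)

Notation code_type n := {ffun 'I_(n.+1 ^ 2).+1 -> int}.

Section coded_paths.
Context {R : realType}.
Implicit Types (f : R -> R).

Definition code n f : code_type n := [ffun i : 'I__ => codes n f i].

Definition decoded n (c : code_type n) : R -> R := codes_path n (fun i => c (inord i)).

Lemma decoded_code n f : decoded (code n f) = codes_path n (codes n f).
Proof.
rewrite /decoded /codes_path; apply/funext => t; rewrite /interp.
congr (unround n _ + _); first by rewrite ffunE inordK.
by apply: eq_big_nat => i /andP[_ ilt]; rewrite ffunE inordK.
Qed.

Lemma decoded_continuous n (c : code_type n) :
  {within `[0, +oo[, continuous (decoded c)}.
Proof. exact/continuous_subspaceT/codes_path_continuous. Qed.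

Lemma restricted_decoded_cvg f (cf : {within `[0, +oo[, continuous f}) :
  restricted (@decoded_continuous n (code n f)) @[n --> \oo] --> restricted cf.
Proof.
apply: cpath_cvg => N e e0.
apply: filterS (codes_path_close N.+1%:R cf e0) => n h t /andP[t1 t2] /=.
rewrite decoded_code; apply: h.
by rewrite t2 andbT (le_trans _ t1)// invr_ge0.
Qed.

Lemma integrated_decoded_cvg f (cf : {within `[0, +oo[, continuous f}) :
  integrated (@decoded_continuous n (code n f)) @[n --> \oo] --> integrated cf.
Proof.
apply: cpath_cvg => N e e0.
have e1 : 0 < e / N.+1%:R by rewrite divr_gt0.
apply: filterS (codes_path_close N.+1%:R cf e1) => n h t /andP[t1 t2] /=.
have t0 : 0 <= t by rewrite (le_trans _ t1)// invr_ge0.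
rewrite decoded_code (le_trans (@Rintegral_dist_le _ _ _ 0 t (e / N.+1%:R) _ _ _ _))//.
- exact/continuous_subspaceT/codes_path_continuous.
- exact: within_ray_sub cf.
- by move=> s /andP[s0 st]; apply: h; rewrite s0 (le_trans st).
- by rewrite subr0 -mulrA ler_piMr ?(ltW e0)// mulrC ler_pdivrMr// mul1r.
Qed.

Definition cell n (z : int) : set R := `[unround n z, unround n (z + 1)[.

Lemma round_cell n z : round n @^-1` [set z] = cell n z.
Proof.
have k0 : 0 < (n.+1 ^ 3)%:R :> R by rewrite ltr0n expn_gt0.
apply/seteqP; split => u; rewrite /cell /= in_itv/= /unround /round.
  move=> <-; have /andP[h1 h2] := floor_itv ((n.+1 ^ 3)%:R * u).
  by rewrite ler_pdivrMr// ltr_pdivlMr// [u * _]mulrC h1 h2.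
rewrite ler_pdivrMr// ltr_pdivlMr// [u * _]mulrC => h.
exact: floor_def.
Qed.

Lemma cell_measurable n z : measurable (cell n z).
Proof. exact: measurable_itv. Qed.

Lemma code_countable_valued d (T : measurableType d) n (U : R -> T -> R) :
  (forall t, 0 <= t -> measurable_fun [set: T] (U t)) ->
  countable_valued (fun w => code n (fun t => U t w)).
Proof.
move=> mU c.
rewrite (_ : _ @^-1` _ = \bigcap_(i in [set: 'I_(n.+1 ^ 2).+1])
    [set w | codes n (fun t => U t w) i = c i]); last first.
  apply/seteqP; split => [w /= <- i _ /=|w /= h]; first by rewrite ffunE.
  by apply/ffunP => i; rewrite ffunE h.
apply: fin_bigcap_measurable => // i _.
case: i => -[|i] ilt /=.
  rewrite (_ : [set w | _] = U 0 @^-1` (cell n (c (Ordinal ilt)))).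
    rewrite -[X in measurable X]setTI; apply: mU => //; exact: cell_measurable.
  by rewrite -round_cell.
rewrite (_ : [set w | _] = (U (i.+1%:R / n.+1%:R) \- U (i%:R / n.+1%:R))
    @^-1` (cell n (c (Ordinal ilt)))).
  rewrite -[X in measurable X]setTI; apply: measurable_funB => //.
  - by apply: mU; rewrite divr_ge0.
  - by apply: mU; rewrite divr_ge0.
  - exact: cell_measurable.
by rewrite -round_cell.
Qed.

(** The rounded value at [0] is almost surely [0], and the rounded increments are
    independent, so the law of a code is explicit: no property of the Brownian
    motion remains on the right-hand side. *)
Lemma brownian_code_law d (T : measurableType d) (P : probability T R)
    (B : R -> {RV P >-> R}) n (c : code_type n) : brownian_motion B ->
  P ((fun w => code n (fun t => B t w)) @^-1` [set c]) =
  if c ord0 == 0 then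
    (\big[*%E/1%E]_(i < n.+1 ^ 2)
       normal_prob 0 (Num.sqrt n.+1%:R^-1) (cell n (c (lift ord0 i))))%E
  else 0%E.
Proof.
move=> hB.
set E0 := [set w | round n (B 0 w) = c ord0].
pose t (i : nat) : R := i%:R / n.+1%:R.
set E1 := \bigcap_(i in [set: 'I_(n.+1 ^ 2)])
   ((B (t i.+1) \- B (t i)) @^-1` cell n (c (lift ord0 i))).
have -> : (fun w => code n (fun t => B t w)) @^-1` [set c] = E0 `&` E1.
  apply/seteqP; split => [w /= wc|w [w0 w1] /=].
    split; first by rewrite /E0/= -wc ffunE.
    by move=> i _; rewrite /= -round_cell/= -wc ffunE.
  apply/ffunP => i; rewrite ffunE.
  case: (unliftP ord0 i) => [j ->|-> //].
  by have /= := w1 j I; rewrite -round_cell.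
have mE1 : measurable E1.
  apply: fin_bigcap_measurable => // i _.
  rewrite -[X in measurable X]setTI; apply: measurable_funB => //.
  exact: cell_measurable.
have mE0 : measurable E0.
  rewrite (_ : E0 = B 0 @^-1` cell n (c ord0)); last by rewrite -round_cell.
  rewrite -[X in measurable X]setTI.
  by apply: measurable_funPT => //; exact: cell_measurable.
have [N [mN PN hN]] := bm_start hB.
have round0 : round n (0 : R) = 0 by rewrite /round mulr0 floor0.
have [c0|c0] := eqVneq (c ord0) 0; last first.
  apply: (subset_measure0 _ _ _ PN) => //; first exact: measurableI.
  move=> w [w0 _]; apply: hN => /= Bw0; move: w0 c0.
  by rewrite /E0/= Bw0 round0 => <-; rewrite eqxx.
have -> : P (E0 `&` E1) = P E1.
  apply/eqP; rewrite eq_le; apply/andP; split.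
    by apply: le_measure; rewrite ?inE//; exact: measurableI.
  rewrite -[leLHS](_ : P ((E0 `&` E1) `|` (E1 `\` E0)) = _); last first.
    by rewrite setIC setUIDK.
  rewrite (le_trans (measureU2 _ _ _))//; [exact: measurableI|exact: measurableD|].
  rewrite [X in (_ + X)%E](_ : _ = 0%E) ?adde0//.
  apply: (subset_measure0 _ _ _ PN) => //; first exact: measurableD.
  move=> w [_ w0]; apply: hN => /= Bw0; apply: w0.
  by rewrite /E0/= Bw0 round0 c0.
have t0 : 0 <= t 0%N by rewrite /t mul0r.
have tmono : {homo t : i j / (i <= j)%N >-> i <= j}.
  by move=> i j ij; rewrite ler_pM2r ?invr_gt0// ler_nat.
rewrite (bm_independent hB t0 tmono) => [|i]; last exact: cell_measurable.
apply: eq_bigr => i _.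
have ti : 0 <= t i by rewrite /t divr_ge0.
have tii : t i < t i.+1 by rewrite ltr_pM2r ?invr_gt0// ltr_nat.
rewrite (bm_gaussian hB ti tii (@cell_measurable n (c (lift ord0 i)))).
by rewrite (_ : t i.+1 - t i = n.+1%:R^-1)// /t -mulrBl -natr1 addrAC subrr add0r mul1r.
Qed.

End coded_paths.

Section path_functionals.
Context {R : realType}.

Section brownian_functional.
Context {d : measure_display} {T : measurableType d} (P : probability T R)
  (B : R -> {RV P >-> R}) (hB : brownian_motion B)
  (Phi : cpath R * cpath R -> R) (M : R) (cPhi : continuous Phi)
  (PhiM : forall s, `|Phi s| <= M).

Let decoded_pair n (c : code_type n) :=
  (restricted (@decoded_continuous R n c), integrated (@decoded_continuous R n c)).

(** A code determines an approximation of the path together with the primitive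
    of that approximation; both converge. *)
Lemma brownian_functional_limit :
  measurable_fun [set: T]
    (fun w => Phi (restricted (bm_continuous hB w), integrated (bm_continuous hB w))) /\
  ('E_P[(Phi \o @decoded_pair n) \o (fun w => code n (fun t => B t w))] @[n --> \oo] -->
   'E_P[fun w => Phi (restricted (bm_continuous hB w), integrated (bm_continuous hB w))])%E.
Proof.
apply: (@countable_limit_expectation R d T P _ (fun n => code_type n : countType)
  (fun n w => code n (fun t => B t w)) decoded_pair
  (fun w => (restricted (bm_continuous hB w), integrated (bm_continuous hB w))) Phi M) => //.
- by move=> n; apply: code_countable_valued => t _; exact: measurable_funPT.
- move=> w; exact: (cvg_pair (@restricted_decoded_cvg R _ (bm_continuous hB w))
                             (@integrated_decoded_cvg R _ (bm_continuous hB w))).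
Qed.

End brownian_functional.

(** Both expectations are limits of expectations of the same functions of the
    codes, whose law is the same for any two Brownian motions. *)
Lemma brownian_motion_law d (T : measurableType d) (P : probability T R)
    (B : R -> {RV P >-> R}) (hB : brownian_motion B)
    d' (T' : measurableType d') (P' : probability T' R)
    (W : R -> {RV P' >-> R}) (hW : brownian_motion W)
    (Phi : cpath R * cpath R -> R) (M : R) :
  continuous Phi -> (forall s, `|Phi s| <= M) ->
  ('E_P[fun w => Phi (restricted (bm_continuous hB w), integrated (bm_continuous hB w))] =
   'E_P'[fun w => Phi (restricted (bm_continuous hW w), integrated (bm_continuous hW w))])%E.
Proof.
move=> cPhi PhiM.
have [_ limB] := brownian_functional_limit hB cPhi PhiM.
have [_ limW] := brownian_functional_limit hW cPhi PhiM.
apply: (cvg_unique (@ereal_hausdorff R) limB); apply: cvg_trans limW.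
apply: near_eq_cvg; apply: nearW => n.
apply: (@countable_valued_expectation _ _ _ _ _ _ _ _ _ _ _ M).
- by apply: code_countable_valued => t _; exact: measurable_funPT.
- by apply: code_countable_valued => t _; exact: measurable_funPT.
- by move=> c; rewrite !brownian_code_law.
- by move=> c; exact: PhiM.
Qed.

Lemma path_functional_measurable d (T : measurableType d) (U1 U2 : R -> T -> R)
    (cU1 : forall w, {within `[0, +oo[, continuous (U1 ^~ w)})
    (cU2 : forall w, {within `[0, +oo[, continuous (U2 ^~ w)})
    (P : probability T R) (Phi : cpath R * cpath R -> R) (M : R) :
  (forall t, 0 <= t -> measurable_fun [set: T] (U1 t)) ->
  (forall t, 0 <= t -> measurable_fun [set: T] (U2 t)) ->
  continuous Phi -> (forall s, `|Phi s| <= M) ->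
  measurable_fun [set: T] (fun w => Phi (restricted (cU1 w), restricted (cU2 w))).
Proof.
move=> mU1 mU2 cPhi PhiM.
pose p n (c : code_type n * code_type n) :=
  (restricted (@decoded_continuous R n c.1), restricted (@decoded_continuous R n c.2)).
have [] // := @countable_limit_expectation R d T P _
    (fun n => (code_type n * code_type n)%type : countType)
    (fun n w => (code n (U1 ^~ w), code n (U2 ^~ w))) p
    (fun w => (restricted (cU1 w), restricted (cU2 w))) Phi M.
- move=> n [c1 c2].
  rewrite (_ : _ @^-1` _ = ((fun w => code n (U1 ^~ w)) @^-1` [set c1]) `&`
     ((fun w => code n (U2 ^~ w)) @^-1` [set c2])); last first.
    by apply/seteqP; split => [w [<- <-]|w [/= <- <-]].
  by apply: measurableI; apply: code_countable_valued.
- move=> w; exact: (cvg_pair (@restricted_decoded_cvg R _ (cU1 w))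
                             (@restricted_decoded_cvg R _ (cU2 w))).
Qed.

End path_functionals.

(** * Brownian scaling *)

Section scaling.
Context {R : realType}.
Notation mu := (@lebesgue_measure R).

Let scale (c : R) : R -> measurableTypeR R := *%R c.

Let pushforward_scale (c : R) :
  exists m : {measure set (measurableTypeR R) -> \bar R},
    (m : set _ -> _) = pushforward mu (scale c).
Proof.
have mc : measurable_fun [set: R] (scale c) by exact: measurable_funM.
by unshelve refine (ex_intro _
  (pushforward mu (scale c) : {measure set (measurableTypeR R) -> \bar R}) _).
Qed.

Lemma lebesgue_measure_scale (c : R) (A : set R) : 0 < c -> measurable A ->
  (c%:E * mu ( *%R c @^-1` A))%E = mu A.
Proof.
move=> c0 mA; have [m mE] := pushforward_scale c.
transitivity (mscale (NngNum (ltW c0)) m A); first by rewrite /mscale/= mE.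
apply/esym/lebesgue_measure_unique => //= _ [[a b]] _ <-.
rewrite /mscale/= mE /pushforward/=.
rewrite (_ : _ @^-1` _ = `]a / c, b / c]%classic); last first.
  apply/seteqP; split => x /=; rewrite !in_itv/= ltr_pdivrMr// ler_pdivlMr//;
  by rewrite [x * c]mulrC.
rewrite !lebesgue_measure_itv/= !lte_fin ltr_pM2r ?invr_gt0//.
case: ifPn => _; last by rewrite mule0.
by rewrite -!EFinD -EFinM -mulrBl mulrC divfK// gt_eqF.
Qed.

(** Lebesgue measure is [c] times its image under the dilation by [c]. *)
Lemma ge0_integral_scale (c : R) (f : R -> \bar R) (A : set R) : 0 < c ->
  measurable A -> measurable_fun [set: R] f -> (forall x, (0 <= f x)%E) ->
  (\int[mu]_(x in A) f x =
   c%:E * \int[mu]_(x in *%R c @^-1` A) f (c * x)%R)%E.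
Proof.
move=> c0 mA mf f0; have [m mE] := pushforward_scale c.
have mc : measurable_fun [set: R] (scale c) by exact: measurable_funM.
have -> : (\int[mu]_(x in A) f x = \int[mscale (NngNum (ltW c0)) m]_(x in A) f x)%E.
  apply: eq_measure_integral => B mB _.
  transitivity (c%:E * m B)%E; last by [].
  by rewrite mE; exact/esym/lebesgue_measure_scale.
rewrite ge0_integral_mscale//=; last exact: measurable_funS mf.
by rewrite mE ge0_integral_pushforward//; exact: measurable_funS mf.
Qed.

Lemma normal_prob_scale (c s : R) (A : set R) : 0 < c -> 0 < s -> measurable A ->
  normal_prob 0 s ( *%R c @^-1` A) = normal_prob 0 (c * s) A.
Proof.
move=> c0 s0 mA; rewrite /normal_prob [RHS](@ge0_integral_scale c)//.
- rewrite -ge0_integralZl//=.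
  + apply: eq_integral => x _; rewrite -EFinM; congr (_%:E).
    rewrite !normal_pdfE ?gt_eqF ?mulr_gt0// /normal_peak /normal_fun !subr0.
    rewrite mulrA; congr (_ * expR _); last first.
      by field; rewrite !gt_eqF.
    rewrite (_ : (c * s) ^+ 2 * pi *+ 2 = c ^+ 2 * (s ^+ 2 * pi *+ 2)); last first.
      by rewrite exprMn mulrnAr mulrA.
    rewrite sqrtrM ?sqr_ge0// sqrtr_sqr gtr0_norm//.
    by rewrite invfM mulrA divff ?mul1r// gt_eqF.
  + rewrite -[X in measurable X]setTI; exact: measurable_funM.
  + apply/measurable_EFinP; apply: measurable_funS (measurableT) _ _ => //.
    by apply: measurableT_comp; [exact: measurable_normal_pdf|exact: measurable_funM].
  + by move=> x _; rewrite lee_fin normal_pdf_ge0.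
  + by rewrite lee_fin ltW.
- by apply/measurable_EFinP; exact: measurable_normal_pdf.
- by move=> x; rewrite lee_fin normal_pdf_ge0.
Qed.

Context {d : measure_display} {T : measurableType d} (P : probability T R).

Lemma rescale_measurable (B : R -> {RV P >-> R}) (eps : R) (t : R) :
  measurable_fun [set: T] (fun w => Num.sqrt eps * B (t / eps) w).
Proof. by apply: measurable_funM => //; exact: measurable_funPT. Qed.

Definition brownian_rescale (B : R -> {RV P >-> R}) (eps t : R) : {RV P >-> R} :=
  MeasurableFun.Pack (MeasurableFun.Class
    (isMeasurableFun.Build _ _ _ _ _ (rescale_measurable B eps t))).

(** The factor [Num.sqrt eps] turns the variance [(t - s) / eps] of an increment
    over [[s / eps, t / eps]] back into [t - s]. *)
Lemma brownian_motion_rescale (B : R -> {RV P >-> R}) (eps : R) : 0 < eps ->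
  brownian_motion B -> brownian_motion (brownian_rescale B eps).
Proof.
move=> e0 hB; have s0 : 0 < Num.sqrt eps by rewrite sqrtr_gt0.
have incr s t : brownian_rescale B eps t \- brownian_rescale B eps s =
    *%R (Num.sqrt eps) \o (B (t / eps) \- B (s / eps)).
  by apply/funext => w; rewrite /= mulrBr.
split.
- have [N [mN PN hN]] := bm_start hB; exists N; split => // w /= h; apply: hN.
  by move=> /= h'; apply: h; rewrite mul0r h' mulr0.
- move=> w; have c := dilation_continuous e0 (bm_continuous hB w).
  by move=> t; apply: cvgM; [exact: cvg_cst|exact: c].
- move=> s t s0' st A mA.
  have se : 0 <= s / eps by rewrite divr_ge0// ltW.
  have ste : s / eps < t / eps by rewrite ltr_pM2r ?invr_gt0.
  have mA' : measurable ( *%R (Num.sqrt eps) @^-1` A).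
    by rewrite -[X in measurable X]setTI; exact: measurable_funM.
  have ts : 0 < Num.sqrt (t / eps - s / eps) by rewrite sqrtr_gt0 subr_gt0.
  have sqE : Num.sqrt eps * Num.sqrt (t / eps - s / eps) = Num.sqrt (t - s).
    by rewrite -sqrtrM ?ltW// -mulrBl mulrC divfK// gt_eqF.
  rewrite incr comp_preimage (bm_gaussian hB se ste mA').
  rewrite (normal_prob_scale s0 ts mA) sqE; reflexivity.
- move=> n t t0 tmono A mA.
  have mA' i : measurable ( *%R (Num.sqrt eps) @^-1` A i).
    by rewrite -[X in measurable X]setTI; exact: measurable_funM.
  have t0' : 0 <= t 0%N / eps by rewrite divr_ge0// ltW.
  have tmono' : {homo (fun i => t i / eps) : i j / (i <= j)%N >-> i <= j}.
    by move=> i j ij; rewrite ler_pM2r ?invr_gt0// tmono.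
  have := bm_independent hB t0' tmono' mA'.
  under eq_bigcapr do rewrite -comp_preimage -incr.
  by under eq_bigr do rewrite -comp_preimage -incr.
Qed.

End scaling.

(** * Gaussian tails and dyadic chaining *)

Section gaussian_tail.
Context {R : realType}.
Notation mu := (@lebesgue_measure R).

Lemma norm_gt_measurable (x : R) : measurable [set u : R | x < `|u|].
Proof.
rewrite (_ : [set u : R | _] = (fun u : R => `|u|) @^-1` `]x, +oo[%classic); last first.
  by apply/seteqP; split => u /=; rewrite in_itv/= andbT.
by rewrite -[X in measurable X]setTI; exact: normr_measurable.
Qed.

(** Beyond [x] standard deviations, half of the exponent of the density pays for
    the factor [expR (- (x ^+ 2 / 4))]; the other half is, up to normalisation,
    again a Gaussian density. *)
Lemma normal_tail (s x : R) : 0 < s -> 0 <= x ->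
  (normal_prob 0 s [set u | (s * x < `|u|)%R] <= (2 * expR (- (x ^+ 2 / 4)))%:E)%E.
Proof.
move=> s0 x0; set A := [set u | _]; set k := 2 * _.
have mA : measurable A by exact: norm_gt_measurable.
have k0 : 0 <= k by rewrite mulr_ge0// expR_ge0.
have q0 : 0 < Num.sqrt 2 * s by rewrite mulr_gt0// sqrtr_gt0.
have kpdf : measurable_fun [set: R] (fun u => (k * normal_pdf 0 (Num.sqrt 2 * s) u)%:E).
  by apply/measurable_EFinP; apply: measurable_funM => //; exact: measurable_normal_pdf.
rewrite /normal_prob.
apply: (@le_trans _ _ (\int[mu]_(u in A) (k * normal_pdf 0 (Num.sqrt 2 * s) u)%:E)%E).
  apply: ge0_le_integral => //=.
  - by move=> u _; rewrite lee_fin normal_pdf_ge0.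
  - apply/measurable_EFinP; apply: measurable_funS measurableT _ _ => //.
    exact: measurable_normal_pdf.
  - exact: measurable_funS kpdf.
  - move=> u; rewrite /A/= lee_fin => xu.
    rewrite !normal_pdfE ?gt_eqF// /normal_peak /normal_fun !subr0.
    have s2 : 1 <= Num.sqrt 2 :> R by rewrite -[leLHS]sqrtr1 ler_wsqrtr// ler1n.
    have s22 : Num.sqrt 2 ^+ 2 = 2 :> R by rewrite sqr_sqrtr.
    have s21 : Num.sqrt 2 <= 2 :> R.
      by rewrite -[leRHS]s22 expr2 ler_peMl// ltW// (lt_le_trans _ s2).
    rewrite (_ : (Num.sqrt 2 * s) ^+ 2 * pi *+ 2 = 2 * (s ^+ 2 * pi *+ 2)); last first.
      by rewrite exprMn s22 mulrnAr mulrA.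
    rewrite sqrtrM// invfM exprMn s22.
    set c := (Num.sqrt (s ^+ 2 * pi *+ 2))^-1.
    have c0 : 0 <= c by rewrite invr_ge0 sqrtr_ge0.
    have -> : expR (- u ^+ 2 / (s ^+ 2 *+ 2)) =
        expR (- (u ^+ 2 / s ^+ 2 / 4)) * expR (- u ^+ 2 / (2 * s ^+ 2 *+ 2)).
      rewrite -expRD; congr expR; field; rewrite gt_eqF//.
    rewrite /k.
    have e1 : expR (- (u ^+ 2 / s ^+ 2 / 4)) <= expR (- (x ^+ 2 / 4)).
      rewrite ler_expR lerN2 ler_pM2r// ler_pdivlMr ?exprn_gt0//.
      rewrite -exprMn -[leRHS]real_normK ?num_real// mulrC.
      by rewrite lerXn2r ?nnegrE ?normr_ge0 ?mulr_ge0// ltW.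
    have e2 : 1 <= 2 * (Num.sqrt 2)^-1 :> R.
      by rewrite ler_pdivlMr ?mul1r// (lt_le_trans _ s2).
    set g := expR (- u ^+ 2 / _).
    have g0 : 0 <= g by exact: expR_ge0.
    have cg0 : 0 <= c * g by rewrite mulr_ge0.
    have E0 : 0 <= expR (- (x ^+ 2 / 4)) by exact: expR_ge0.
    rewrite (_ : c * _ = expR (- (u ^+ 2 / s ^+ 2 / 4)) * (c * g)); last by rewrite mulrCA.
    apply: (le_trans (ler_wpM2r cg0 e1)).
    rewrite (_ : 2 * _ * _ = (2 / Num.sqrt 2) * (expR (- (x ^+ 2 / 4)) * (c * g))); last first.
      by rewrite -!mulrA; congr (_ * _); rewrite mulrCA; congr (_ * _); rewrite mulrCA.
    by rewrite ler_peMl// mulr_ge0.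
apply: (@le_trans _ _ (\int[mu]_u (k * normal_pdf 0 (Num.sqrt 2 * s) u)%:E)%E).
  apply: ge0_subset_integral => //.
  by move=> u _; rewrite lee_fin mulr_ge0// normal_pdf_ge0.
under eq_integral do rewrite EFinM.
rewrite ge0_integralZl//.
- by rewrite integral_normal_pdf mule1.
- by apply/measurable_EFinP; exact: measurable_normal_pdf.
- by move=> u _; rewrite lee_fin normal_pdf_ge0.
Qed.

End gaussian_tail.

Section chaining.
Context {R : realType}.
Implicit Types (f : R -> R).

(** Every point of level [k.+1] is a point of level [k] or adjacent to one. *)
Lemma dyadic_bound f (L : R) (a : nat -> R) :
  (forall k i, (i < 2 ^ k)%N ->
     `|f (i.+1%:R * (L / 2 ^+ k)) - f (i%:R * (L / 2 ^+ k))| <= a k) ->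
  forall k i, (i <= 2 ^ k)%N ->
    `|f (i%:R * (L / 2 ^+ k))| <= `|f 0| + \sum_(0 <= m < k.+1) a m.
Proof.
move=> fa; have a0 k : 0 <= a k.
  by apply: le_trans (fa k 0%N _); rewrite ?expn_gt0.
elim=> [|k IH] i.
  rewrite expn0 big_nat1 expr0 divr1 leq_eqVlt ltnS leqn0 => /predU1P[->|/eqP ->].
    have := fa 0%N 0%N isT; rewrite expr0 divr1 mul1r mul0r => h.
    by rewrite -[X in `|X|](subrK (f 0)) addrC (le_trans (ler_normD _ _))// lerD2l.
  by rewrite mul0r lerDl.
have half j : (j.*2)%:R * (L / 2 ^+ k.+1) = j%:R * (L / 2 ^+ k).
  by rewrite -muln2 natrM exprS invfM; field; rewrite expf_neq0.
rewrite big_nat_recr//= addrA => ik.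
have i2 : (i./2 <= 2 ^ k)%N.
  by rewrite leq_half_double -mul2n -expnS -addn1 (leq_trans ik)// leq_addr.
have := odd_double_half i; case: (odd i) => /= iE.
  have ik' : (i./2.*2 < 2 ^ k.+1)%N by move: ik; rewrite -{1}iE add1n.
  have := fa k.+1 _ ik'; rewrite -add1n iE half => h.
  rewrite -[X in `|X|](subrK (f (i./2%:R * (L / 2 ^+ k)))) addrC.
  by rewrite (le_trans (ler_normD _ _))// lerD// IH.
by rewrite -iE add0n half (le_trans (IH _ i2))// lerDl.
Qed.

(** Dyadic points are dense: [t] is approximated by the dyadic point just below
    it. *)
Lemma chaining_bound f (L A : R) (a : nat -> R) :
  {within `[0, +oo[, continuous f} -> 0 < L ->
  (forall k i, (i < 2 ^ k)%N ->
     `|f (i.+1%:R * (L / 2 ^+ k)) - f (i%:R * (L / 2 ^+ k))| <= a k) ->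
  (forall k, \sum_(0 <= m < k.+1) a m <= A) ->
  forall t, 0 <= t <= L -> `|f t| <= `|f 0| + A.
Proof.
move=> cf L0 fa aA t /andP[t0 tL]; apply/ler_addgt0Pr => e e0.
have [d d0 hd] := uniform_continuity (within_ray_sub (b := L) (lexx 0) cf) e0.
have [k kd] : exists k, L / 2 ^+ k < d.
  have : L * (@GRing.exp R 2^-1) n @[n --> \oo] --> L * 0.
    apply: cvgM; first exact: cvg_cst.
    by apply: cvg_expr; rewrite ger0_norm ?invr_ge0// invf_lt1 ?ltr1n.
  rewrite mulr0 => /cvgr0Pnorm_lt /(_ _ d0)[N _ /(_ N)].
  by rewrite /= leqnn => /(_ isT) h; exists N; rewrite -exprVn (le_lt_trans (ler_norm _)).
set l := L / 2 ^+ k in kd.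
have l0 : 0 < l by rewrite divr_gt0// exprn_gt0.
have tl0 : 0 <= t / l by rewrite divr_ge0// ltW.
have /andP[] := truncn_itv tl0; set i := Num.truncn _ => it ti.
rewrite ler_pdivlMr// in it; rewrite ltr_pdivrMr// -natr1 mulrDl mul1r in ti.
have ik : (i <= 2 ^ k)%N.
  rewrite -(ler_nat R) natrX -(ler_pM2r l0) (le_trans it)// (le_trans tL)//.
  by rewrite /l mulrC divfK// expf_neq0.
have := dyadic_bound fa ik; rewrite -/l => h.
have il0 : 0 <= i%:R * l by rewrite mulr_ge0// ltW.
have hdt : `|f t - f (i%:R * l)| <= e.
  apply: hd; [by rewrite t0|by rewrite il0 (le_trans it)|].
  by rewrite ger0_norm ?subr_ge0//; lra.
have := ler_normD (f t - f (i%:R * l)) (f (i%:R * l)); rewrite subrK.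
by have := aA k; lra.
Qed.

Lemma linear_le_geometric (th : R) n : 1 < th ->
  n.+1%:R <= (1 + (th - 1)^-1) * th ^+ n.
Proof.
move=> th1; have h0 : 0 < (th - 1)^-1 by rewrite invr_gt0 subr_gt0.
have bern : 1 + n%:R * (th - 1) <= th ^+ n.
  elim: n => [|n IH]; first by rewrite mul0r addr0 expr0.
  rewrite exprS -natr1.
  have n0 : 0 <= n%:R * (th - 1) ^+ 2 by rewrite mulr_ge0// sqr_ge0.
  have : th * (1 + n%:R * (th - 1)) <= th * th ^+ n by rewrite ler_pM2l//; lra.
  apply: le_trans; rewrite -subr_ge0 [X in 0 <= X](_ : _ = n%:R * (th - 1) ^+ 2)//.
  by ring.
apply: (@le_trans _ _ ((1 + (th - 1)^-1) * (1 + n%:R * (th - 1)))).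
  have n0 : 0 <= n%:R * (th - 1) by rewrite mulr_ge0// subr_ge0 ltW.
  rewrite -subr_ge0 [X in 0 <= X](_ : _ = n%:R * (th - 1) + (th - 1)^-1).
    by rewrite addr_ge0// ltW.
  by field; rewrite subr_eq0 gt_eqF.
by rewrite ler_pM2l//; lra.
Qed.

(** With [th = b / Num.sqrt 2 > 1], the linear factor [(n + k).+1] is at most a
    constant times [th ^+ (n + k)], so that the bound at level [k] is of order
    [b ^+ n * (b / 2) ^+ k], which is summable in [k]. *)
Lemma dyadic_growth (b : R) : Num.sqrt 2 < b -> b < 2 ->
  exists C : R, 0 <= C /\ forall (f : R -> R) n, {within `[0, +oo[, continuous f} ->
  (forall k i, (i < 2 ^ k)%N ->
     `|f (i.+1%:R * (2 ^+ n / 2 ^+ k)) - f (i%:R * (2 ^+ n / 2 ^+ k))| <=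
      4 * (n + k).+1%:R * Num.sqrt (2 ^+ n / 2 ^+ k)) ->
  forall t, 0 <= t <= 2 ^+ n -> `|f t| <= `|f 0| + C * b ^+ n.
Proof.
move=> b1 b2.
have s0 : 0 < Num.sqrt 2 :> R by rewrite sqrtr_gt0.
have b0 : 0 < b by exact: lt_trans b1.
set th := b / Num.sqrt 2.
have th1 : 1 < th by rewrite ltr_pdivlMr// mul1r.
set c := 1 + (th - 1)^-1.
have c0 : 0 < c by rewrite addr_gt0// invr_gt0 subr_gt0.
have kap : 0 < 1 - b / 2 by lra.
exists (4 * c / (1 - b / 2)); split.
  by rewrite divr_ge0 ?mulr_ge0 ?ltW.
move=> f n cf fa.
apply: (chaining_bound (a := fun k => 4 * (c * th ^+ (n + k)) * Num.sqrt (2 ^+ n / 2 ^+ k)) cf).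
- by rewrite exprn_gt0.
- move=> k i ik; rewrite (le_trans (fa k i ik))// ler_wpM2r ?sqrtr_ge0//.
  by rewrite ler_pM2l// linear_le_geometric.
- move=> k.
  have aE m : 4 * (c * th ^+ (n + m)) * Num.sqrt (2 ^+ n / 2 ^+ m) =
      4 * c * b ^+ n * (b / 2) ^+ m.
    have sX j : 2 ^+ j = Num.sqrt 2 ^+ j * Num.sqrt 2 ^+ j :> R.
      by rewrite -exprMn -expr2 sqr_sqrtr.
    have -> : 2 ^+ n / 2 ^+ m = (Num.sqrt 2 ^+ n / Num.sqrt 2 ^+ m) ^+ 2 :> R.
      by rewrite expr_div_n !sX !expr2.
    rewrite sqrtr_sqr ger0_norm; last by rewrite divr_ge0// exprn_ge0// ltW.
    rewrite exprD /th !expr_div_n sX.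
    by field; rewrite !expf_neq0// gt_eqF.
  under eq_bigr do rewrite aE.
  rewrite -big_distrr/= [leRHS](_ : _ = 4 * c * b ^+ n * (1 - b / 2)^-1); last first.
    by rewrite -!mulrA; congr (_ * (_ * _)); rewrite mulrC.
  rewrite ler_pM2l ?mulr_gt0 ?exprn_gt0//.
  rewrite -[leRHS]mul1r ler_pdivlMr//.
  have -> : (\sum_(0 <= m < k.+1) (b / 2) ^+ m) * (1 - b / 2) = 1 - (b / 2) ^+ k.+1.
    elim: k => [|k IH]; first by rewrite big_nat1 expr0 expr1 mul1r.
    by rewrite big_nat_recr//= mulrDl IH [in RHS]exprSr; ring.
  by rewrite lerBlDr lerDl exprn_ge0// divr_ge0// ltW.
Qed.

End chaining.

(** * Growth of Brownian paths *)

Section brownian_growth.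
Context {R : realType} {d : measure_display} {T : measurableType d}
  (P : probability T R) (B : R -> {RV P >-> R}) (hB : brownian_motion B).

Lemma brownian_increment_tail (s t x : R) : 0 <= s -> s < t -> 0 <= x ->
  (P [set w | (Num.sqrt (t - s) * x < `|B t w - B s w|)%R] <=
   (2 * expR (- (x ^+ 2 / 4)))%:E)%E.
Proof.
move=> s0 st x0.
have ts : 0 < Num.sqrt (t - s) by rewrite sqrtr_gt0 subr_gt0.
have := bm_gaussian hB s0 st (norm_gt_measurable (Num.sqrt (t - s) * x)).
rewrite (_ : _ @^-1` _ = [set w | Num.sqrt (t - s) * x < `|B t w - B s w|]); last by [].
by move=> ->; exact: normal_tail.
Qed.

(** [Num.sqrt l] is the standard deviation of an increment over a time [l]. *)
Definition large_increment (j k i : nat) : set T :=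
  let l := 2 ^+ (j - k) / 2 ^+ k in
  [set w | Num.sqrt l * (4 * j.+1%:R) < `|B (i.+1%:R * l) w - B (i%:R * l) w|].

(** Grouping time scale [n] and level [k] by [j = n + k] leaves a single series of
    probabilities: at most [j.+1 * 2 ^ j] increments contribute to the [j]-th
    event, each with probability at most [2 / 16 ^+ j.+1]. *)
Definition large_increments (j : nat) : set T :=
  \big[setU/set0]_(k < j.+1) \big[setU/set0]_(i < 2 ^ k) large_increment j k i.

Lemma large_increment_measurable j k i : measurable (large_increment j k i).
Proof.
pose l : R := 2 ^+ (j - k) / 2 ^+ k.
rewrite (_ : large_increment j k i = (B (i.+1%:R * l) \- B (i%:R * l)) @^-1`
  [set u | Num.sqrt l * (4 * j.+1%:R) < `|u|])//.
rewrite -[X in measurable X]setTI; apply: measurable_funB => //.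
exact: norm_gt_measurable.
Qed.

Lemma large_increments_measurable j : measurable (large_increments j).
Proof.
by apply: bigsetU_measurable => k _; apply: bigsetU_measurable => i _;
  exact: large_increment_measurable.
Qed.

Lemma large_increment_prob j k i :
  (P (large_increment j k i) <= (2 / 16 ^+ j.+1)%:E)%E.
Proof.
pose l : R := 2 ^+ (j - k) / 2 ^+ k.
have l0 : 0 < l by rewrite divr_gt0// exprn_gt0.
have x0 : 0 <= 4 * j.+1%:R :> R by rewrite mulr_ge0.
have il0 : 0 <= i%:R * l by rewrite mulr_ge0// ltW.
have il : i%:R * l < i.+1%:R * l by rewrite ltr_pM2r// ltr_nat.
have := brownian_increment_tail il0 il x0.
rewrite (_ : i.+1%:R * l - i%:R * l = l); last by rewrite -natr1; ring.
move=> h; apply: (le_trans h).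
rewrite lee_fin ler_pM2l// expRN lef_pV2 ?posrE ?expR_gt0 ?exprn_gt0//.
have e1 : 2 <= expR 1 :> R by rewrite (le_trans _ (expR_ge1Dx 1))//; lra.
rewrite (_ : (4 * j.+1%:R) ^+ 2 / 4 = 1 * (4 * j.+1 ^ 2)%:R); last first.
  by rewrite natrM natrX; field.
rewrite expRM_natr exprM.
rewrite (@le_trans _ _ ((expR 1 ^+ 4) ^+ j.+1))//.
  rewrite lerXn2r ?nnegrE ?exprn_ge0 ?expR_ge0//.
  rewrite (_ : 16 = 2 ^+ 4); last by ring.
  by rewrite lerXn2r ?nnegrE ?expR_ge0.
have : 1 <= expR 1 ^+ 4 :> R by rewrite exprn_ege1//; lra.
by move=> h4; rewrite ler_weXn2l// expnS expn1 leq_pmulr.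
Qed.

Lemma large_increments_prob j :
  (P (large_increments j) <= (1 / (2 ^ j.+1)%:R)%:E)%E.
Proof.
have inner k : (k <= j)%N ->
   (P (\big[setU/set0]_(i < 2 ^ k) large_increment j k i) <= (2 ^+ j * (2 / 16 ^+ j.+1))%:E)%E.
  move=> kj; rewrite (le_trans (Boole_inequality _ _))//.
    by move=> i _; exact: large_increment_measurable.
  rewrite (@le_trans _ _ (\sum_(i < 2 ^ k) (2 / 16 ^+ j.+1)%:E)%E)//.
    by apply: lee_sum => i _; exact: large_increment_prob.
  rewrite sumEFin lee_fin big_const_ord iter_addr_0 -[leLHS]mulr_natl.
  by rewrite ler_wpM2r ?divr_ge0 ?exprn_ge0// natrX ler_weXn2l// ler1n.
rewrite (le_trans (@Boole_inequality _ _ _ P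
  (fun k => \big[setU/set0]_(i < 2 ^ k) large_increment j k i) _ _))//.
  by move=> k _; apply: bigsetU_measurable => i _; exact: large_increment_measurable.
rewrite (@le_trans _ _ (\sum_(k < j.+1) (2 ^+ j * (2 / 16 ^+ j.+1))%:E)%E)//.
  by apply: lee_sum => k _; apply: inner; rewrite -ltnS.
rewrite sumEFin lee_fin big_const_ord iter_addr_0 -[leLHS]mulr_natl.
have : j.+1%:R <= 2 ^+ j :> R by rewrite -natrX ler_nat ltn_expl.
have p0 : 0 <= 2 ^+ j * (2 / 16 ^+ j.+1) :> R.
  by rewrite mulr_ge0 ?divr_ge0 ?exprn_ge0.
move=> /(ler_wpM2r p0)/le_trans; apply.
have a1 : 1 <= 2 ^+ j :> R by rewrite exprn_ege1// ler1n.
have h16 : 16 ^+ j.+1 = 16 * (2 ^+ j) ^+ 4 :> R.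
  by rewrite exprS -exprM mulnC exprM; congr (_ * _ ^+ _); ring.
rewrite natrX h16 (exprS _ j); set a := 2 ^+ j in a1 *.
have a0 : 0 < a by lra.
rewrite [leLHS](_ : _ = (8 * (a * a))^-1); last by field; rewrite gt_eqF.
have aa : a <= a * a by rewrite ler_peMl// ltW.
by rewrite div1r lef_pV2 ?posrE ?mulr_gt0//; lra.
Qed.

(** The bounds [1 / 2 ^ j.+1] are summable, so the Borel-Cantelli lemma applies. *)
Lemma eventually_small_increments :
  {ae P, forall w, exists J, forall j, (J <= j)%N -> ~ large_increments j w}.
Proof.
exists (lim_sup_set large_increments); split.
- apply: bigcapT_measurable => k; apply: bigcup_measurable => j _.
  exact: large_increments_measurable.
- apply: lim_sup_set_cvg0; first exact: large_increments_measurable.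
  apply: (@le_lt_trans _ _ 1%E); last exact: ltry.
  apply: (le_trans _ (@epsilon_trick0 R 1 xpredT ler01)).
  by apply: lee_nneseries => // j _; exact: large_increments_prob.
- move=> w /= h J _; apply: contrapT => nh; apply: h; exists J => j Jj wj.
  by apply: nh; exists j.
Qed.

(** Weaker than the law of the iterated logarithm, but any exponent above [1/2]
    suffices. On [[0, 2 ^+ n]] the bound comes from [dyadic_growth] with
    [b = 2 `^ p]. *)
Lemma brownian_growth (t0 p : R) : 0 < t0 -> 2^-1 < p -> p < 1 ->
  {ae P, forall w, exists C, forall t, t0 <= t -> `|B t w| <= C * t `^ p}.
Proof.
move=> t00 p1 p2.
have l2 : 1 < 2 :> R by rewrite ltr1n.
have b1 : Num.sqrt 2 < 2 `^ p :> R.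
  by rewrite -powR12_sqrt// /powR gt_eqF// ltr_expR ltr_pM2r// ln_gt0.
have b2 : 2 `^ p < 2 :> R.
  rewrite -[ltRHS]powRr1// /powR gt_eqF// ltr_expR ltr_pM2r// ln_gt0//.
have [K [K0 hK]] := dyadic_growth b1 b2.
set b := 2 `^ p in b1 b2 hK.
have b0 : 0 < b by rewrite powR_gt0.
apply: filterS eventually_small_increments => w [J hJ].
have grow n t : (J <= n)%N -> 0 <= t <= 2 ^+ n -> `|B t w| <= `|B 0 w| + K * b ^+ n.
  move=> Jn; apply: (hK _ n (bm_continuous hB w)) => k i ik.
  rewrite leNgt; apply/negP => large.
  apply: (hJ (n + k)%N); first by rewrite (leq_trans Jn)// leq_addr.
  rewrite /large_increments -(bigcup_mkord _
    (fun m => \big[setU/set0]_(i < 2 ^ m) large_increment (n + k) m i)).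
  have kk : (k < (n + k).+1)%N by rewrite ltnS leq_addl.
  exists k => //.
  rewrite -(bigcup_mkord _ (large_increment (n + k) k)); exists i => //.
  by rewrite /large_increment/= addnK mulrC.
set D := `|B 0 w| + K * b ^+ J.
have D0 : 0 <= D by rewrite addr_ge0// mulr_ge0// exprn_ge0// ltW.
exists (D / t0 `^ p + K * b) => t t0t.
have t0' : 0 < t by exact: lt_le_trans t0t.
have tp : t0 `^ p <= t `^ p.
  by rewrite ge0_ler_powR ?nnegrE ?(ltW t00) ?(ltW t0')//; lra.
have t0p : 0 < t0 `^ p by rewrite powR_gt0.
suff h : `|B t w| <= D + K * b * t `^ p.
  rewrite (le_trans h)// mulrDl lerD2r mulrAC ler_pdivlMr// ler_wpM2l//.
have exn : exists n, t <= 2 ^+ n.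
  exists (Num.truncn t).+1; rewrite ltW// (lt_le_trans (truncnS_gt t))//.
  by rewrite -natrX ler_nat ltnW// ltn_expl.
have Kb : 0 <= K * b * t `^ p by rewrite !mulr_ge0 ?powR_ge0// ltW.
(* Unless it is [0], the least [n] with [t <= 2 ^+ n] satisfies [2 ^+ n < 2 * t]. *)
case: (ex_minnP exn) => -[|m] tm minm.
  rewrite (le_trans (@grow J t (leqnn J) _)) ?lerDl//.
  by rewrite ltW//= (le_trans tm)// expr0 exprn_ege1// ler1n.
have mt : 2 ^+ m < t.
  by rewrite ltNge; apply/negP => /minm; rewrite ltnn.
have [Jm|mJ] := leqP J m.
  rewrite (le_trans (@grow m.+1 t (leqW Jm) _)) ?(ltW t0')// /D -addrA lerD2l.
  have bm : b ^+ m <= t `^ p.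
    rewrite /b -powR_mulrn ?powR_ge0// -powRrM mulrC powRrM powR_mulrn//.
    by rewrite ge0_ler_powR ?nnegrE ?exprn_ge0 ?(ltW t0') ?(ltW mt)//; lra.
  rewrite (@le_trans _ _ (K * b * t `^ p))//.
    by rewrite exprS mulrA ler_wpM2l// mulr_ge0// ltW.
  by rewrite lerDr mulr_ge0// exprn_ge0// ltW.
rewrite (le_trans (@grow J t (leqnn J) _)) ?lerDl//.
by rewrite ltW//= (le_trans tm)// ler_weXn2l// ler1n.
Qed.

End brownian_growth.

(** * Power functions and last passage times *)

Section homogeneous_bound.
Context {R : realType}.

Lemma pos_homogeneous_le (gamma : R) (H : R -> R) : 0 <= gamma ->
  pos_homogeneous gamma H ->
  exists K, 0 <= K /\ forall v, `|H v| <= K * `|v| `^ gamma.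
Proof.
move=> g0 hH; exists (`|H 0| + `|H 1| + `|H (- 1)|); split.
  by rewrite !addr_ge0.
move=> v; have [v0|v0|->] := ltgtP v 0.
- have -> : v = `|v| * (- 1) by rewrite ltr0_norm// mulrN1 opprK.
  rewrite hH ?normr_gt0 ?lt_eqF// normrM ger0_norm ?powR_ge0//.
  rewrite normrM normr_id normrN normr1 mulr1 mulrC ler_wpM2r ?powR_ge0//.
  by rewrite lerDr addr_ge0.
- have -> : v = `|v| * 1 by rewrite gtr0_norm// mulr1.
  rewrite hH ?normr_gt0 ?gt_eqF// normrM ger0_norm ?powR_ge0//.
  rewrite mulr1 normr_id mulrC ler_wpM2r ?powR_ge0//.
  by rewrite addrAC lerDr addr_ge0.
- have [->|gN0] := eqVneq gamma 0.
    by rewrite powRr0 mulr1 -addrA lerDl addr_ge0.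
  have gp : 0 < gamma by rewrite lt_neqAle eq_sym gN0.
  have := hH 0 2 (ltr0n _ 2); rewrite mulr0 => h.
  have : (2 `^ gamma - 1) * H 0 = 0 by rewrite mulrBl mul1r -h subrr.
  move=> /eqP; rewrite mulf_eq0 subr_eq0 => /orP[/eqP h2|/eqP ->]; last first.
    by rewrite normr0 mulr_ge0 ?powR_ge0// !addr_ge0.
  have : (1 : R) < 2 `^ gamma.
    rewrite -[ltLHS]expR0 /powR gt_eqF// ltr_expR mulr_gt0//.
    by rewrite ln_gt0// ltr1n.
  by rewrite h2 ltxx.
Qed.

Lemma powR_ge_base (a s x : R) : 0 < a -> a <= s -> x <= 0 -> s `^ x <= a `^ x.
Proof.
move=> a0 sa x0; have s0 := lt_le_trans a0 sa.
by rewrite /powR !gt_eqF// ler_expR ler_wnM2l// ler_ln.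
Qed.

Lemma powR_le_base (a s x : R) : 0 < a -> a <= s -> 0 <= x -> a `^ x <= s `^ x.
Proof.
move=> a0 sa x0; have s0 := lt_le_trans a0 sa.
by rewrite /powR !gt_eqF// ler_expR ler_wpM2l// ler_ln.
Qed.

Lemma powRDpos (a x y : R) : 0 < a -> a `^ (x + y) = a `^ x * a `^ y.
Proof. by move=> a0; rewrite powRD// (gt_eqF a0) implybT. Qed.

Lemma powR_continuous (x : R) (s : R) : 0 < s -> {for s, continuous (fun u => u `^ x)}.
Proof.
move=> s0; apply: differentiable_continuous; apply/derivable1_diffP.
by apply: derivable_powR; rewrite in_itv/= andbT.
Qed.

Lemma integral_powR_le (t0 t r : R) : 0 < t0 -> t0 <= t -> 0 < r ->
  \int[@lebesgue_measure R]_(s in `[t0, t]) s `^ (r - 1) <= t `^ r / r.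
Proof.
move=> t00; rewrite le_eqVlt => /predU1P[<-|t0t] r0.
  by rewrite set_itv1 Rintegral_set1 divr_ge0 ?powR_ge0 ?ltW.
rewrite /Rintegral.
have pos u : t0 <= u -> 0 < u by exact: lt_le_trans.
rewrite (@continuous_FTC2 R _ (fun u => u `^ r / r) t0 t)//=.
- by rewrite lerBlDr lerDl divr_ge0 ?powR_ge0 ?ltW.
- apply/continuous_in_subspaceT => u; rewrite inE/= in_itv/= => /andP[u0 _].
  by apply: powR_continuous; exact: pos.
- split.
  + move=> u; rewrite in_itv/= => /andP[u0 _].
    apply: derivableM => //; apply: derivable_powR.
    by rewrite in_itv/= andbT pos// ltW.
  + apply: cvg_at_right_filter; apply: cvgM; last exact: cvg_cst.
    exact: powR_continuous.
  + apply: cvg_at_left_filter; apply: cvgM; last exact: cvg_cst.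
    by apply: powR_continuous; exact: pos (ltW _).
- move=> u; rewrite in_itv/= => /andP[u0 _].
  have up : u \in `]0, +oo[ by rewrite in_itv/= andbT pos// ltW.
  rewrite derive1E deriveMr//; last by apply: derivable_powR.
  rewrite -derive1E powR_derive1// mulrA mulVf ?mul1r// gt_eqF//.
Qed.

End homogeneous_bound.

Section last_passage.
Context {R : realType}.

Lemma last_passage (u : R -> R) (a t0 t : R) : t0 <= t ->
  {within `[t0, t], continuous u} -> u t0 <= a ->
  exists s, [/\ t0 <= s <= t, u s <= a & forall x, s < x -> x <= t -> a < u x].
Proof.
move=> t0t cu ut0.
pose S := [set s | t0 <= s <= t /\ u s <= a].
have St0 : S t0 by rewrite /S/= lexx t0t.
have hS : has_sup S.
  by split; [exists t0|exists t => s [/andP[_ ->]]].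
have s0 : t0 <= sup S by apply: ub_le_sup St0; exact: hS.2.
have st : sup S <= t by apply: ge_sup => [|s [/andP[_ ->]]]//; exists t0.
exists (sup S); split; first by rewrite s0 st.
- rewrite leNgt; apply/negP => us.
  move/subspace_continuousP : cu => /(_ (sup S)).
  rewrite /= in_itv/= s0 st => /(_ isT)/cvgrPdist_lt/(_ (u (sup S) - a)).
  rewrite subr_gt0 => /(_ us); rewrite near_withinE => -[d /= d0 hd].
  have [s [sS us'] sd] := sup_adherent d0 hS.
  have sle : s <= sup S by apply: ub_le_sup; [exact: hS.2|split].
  have := hd s; rewrite /ball_/= ger0_norm ?subr_ge0// ltrBlDr -ltrBlDl.
  rewrite in_itv/= sS => /(_ sd isT).
  by rewrite /from_subspace; have := ler_norm (u (sup S) - u s); lra.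
- move=> x sx xt; rewrite ltNge; apply/negP => ux.
  suff : x <= sup S by rewrite leNgt sx.
  by apply: ub_le_sup; [exact: hS.2|split => //; rewrite xt andbT (le_trans s0)// ltW].
Qed.

End last_passage.

(** * The drift is negligible *)

Section drift.
Context {R : realType}.
Notation mu := (@lebesgue_measure R).
Context (gamma beta t0 v0 p r C K : R) (F V b : R -> R).
Context (gamma0 : 0 <= gamma) (t00 : 0 < t0) (v00 : 0 <= v0)
  (p0 : 0 < p) (r0 : 0 < r) (rp : r <= p) (pr : gamma * p - beta <= r - 1)
  (K0 : 0 <= K) (cF : continuous F) (FK : forall v, `|F v| <= K * `|v| `^ gamma)
  (cV : {within `[t0, +oo[, continuous V})
  (bC : forall t, t0 <= t -> `|b t| <= C * t `^ p)
  (hV : forall t, t0 <= t -> V t = v0 + (b t - b t0) -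
      \int[mu]_(s in `[t0, t]) (s `^ (- beta) * F (V s))).

Let drift t := \int[mu]_(s in `[t0, t]) (s `^ (- beta) * F (V s)).

Let pos t : t0 <= t -> 0 < t. Proof. exact: lt_le_trans. Qed.

Let C0 : 0 <= C.
Proof.
have := le_trans (normr_ge0 _) (bC (lexx t0)).
by rewrite pmulr_lge0// powR_gt0.
Qed.

Let integrand_continuous s t : t0 <= s ->
  {within `[s, t], continuous (fun u => u `^ (- beta) * F (V u))}.
Proof.
move=> t0s; apply/subspace_continuousP => u; rewrite /= in_itv/= => /andP[su ut].
apply: cvgM.
  by apply: cvg_within_filter; apply: powR_continuous; apply: pos; exact: le_trans su.
have /subspace_continuousP cu := within_ray_sub (b := t) t0s cV.
apply: (cvg_comp _ _ (cu u _)); last exact: cF.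
by rewrite /= in_itv/= su.
Qed.

(** The hypothesis [pr] makes the integrand at most a multiple of
    [s `^ (r - 1)]. *)
Let drift_le N t : t0 <= t -> 0 <= N -> (forall s, t0 <= s <= t -> `|V s| <= N * s `^ p) ->
  `|drift t| <= K * N `^ gamma * (t0 `^ (gamma * p - beta - (r - 1)) / r) * t `^ r.
Proof.
move=> t0t N0 VN; set c := t0 `^ _; set k := K * N `^ gamma.
have k0 : 0 <= k by rewrite mulr_ge0 ?powR_ge0.
have c0 : 0 <= c by exact: powR_ge0.
have cpow : {within `[t0, t], continuous (fun s => s `^ (r - 1))}.
  apply: continuous_in_subspaceT => s; rewrite inE/= in_itv/= => /andP[ts _].
  by apply: powR_continuous; exact: pos.
apply: (@le_trans _ _ (\int[mu]_(s in `[t0, t]) (k * c * s `^ (r - 1)))).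
  apply: le_abs_Rintegral; first exact: integrand_continuous.
    by move=> s; apply: cvgM; [exact: cvg_cst|exact: cpow].
  move=> s /andP[ts st]; have s0 := pos ts.
  rewrite normrM ger0_norm ?powR_ge0//.
  apply: (@le_trans _ _ (s `^ (- beta) * (k * s `^ (gamma * p)))).
    rewrite ler_wpM2l ?powR_ge0// (le_trans (FK _))// /k -mulrA ler_wpM2l//.
    rewrite (mulrC gamma) powRrM -powRM ?powR_ge0//.
    rewrite ge0_ler_powR ?nnegrE ?normr_ge0 ?mulr_ge0 ?powR_ge0//.
    by apply: VN; rewrite ts.
  rewrite mulrCA -powRDpos// -mulrA ler_wpM2l//.
  rewrite (_ : - beta + gamma * p = (gamma * p - beta - (r - 1)) + (r - 1)); last by ring.
  rewrite (powRDpos (gamma * p - beta - (r - 1)) (r - 1) s0).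
  by rewrite ler_wpM2r ?powR_ge0// powR_ge_base// subr_le0.
rewrite RintegralZl//; last exact: segment_integrable.
rewrite -!mulrA ler_wpM2l// ler_wpM2l ?powR_ge0// ler_wpM2l//.
by rewrite (le_trans (integral_powR_le _ _ _))// mulrC.
Qed.

Let bC2 s t : t0 <= s -> s <= t -> `|b s| <= C * t `^ p.
Proof.
move=> ts st; rewrite (le_trans (bC ts))// ler_wpM2l// powR_le_base// ?ltW//.
exact: pos.
Qed.

(** Comparison with the last time [s <= t] at which [u s <= v0]: on [(s, t]] the
    drift is nonpositive, so [u] grows at most by the increment of [n]. It is
    applied to [V] and to [- V]. *)
Let one_sided (u n h : R -> R) t : t0 <= t ->
  {within `[t0, +oo[, continuous u} -> {within `[t0, t], continuous h} ->
  u t0 <= v0 -> (forall s, t0 <= s -> `|n s| <= `|b s|) ->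
  (forall s, t0 <= s -> s <= t -> 0 < u s -> 0 <= h s) ->
  (forall s, t0 <= s -> s <= t -> u s = u t0 + (n s - n t0) - \int[mu]_(x in `[t0, s]) h x) ->
  u t <= v0 + 2 * C * t `^ p.
Proof.
move=> t0t cu ch ut0 nb hpos uE.
have [s [/andP[ts st] us above]] := last_passage t0t (within_ray_sub (lexx _) cu) ut0.
have ns := le_trans (nb s ts) (bC2 ts st).
have nt := le_trans (nb t t0t) (bC2 t0t (lexx t)).
have -> : u t = u s + (n t - n s) - \int[mu]_(x in `[s, t]) h x.
  by rewrite (uE s ts st) (uE t t0t (lexx t)) (Rintegral_split ts st ch); ring.
have : 0 <= \int[mu]_(x in `[s, t]) h x.
  rewrite -Rintegral_itv_obnd_cbnd.
    apply: Rintegral_ge0 => x /=; rewrite in_itv/= => /andP[sx xt].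
    apply: hpos => //; first by rewrite (le_trans ts)// ltW.
    exact: le_lt_trans (above x sx xt).
  apply: integrableS (segment_integrable (within_itv_sub ts (lexx t) ch)) => //.
  by move=> x /=; rewrite !in_itv/= => /andP[/ltW -> ->].
have := ler_norm (n t); have := ler_norm (- n s); rewrite normrN; lra.
Qed.

Let growth_confining : (forall v, 0 <= v * F v) ->
  exists N, forall t, t0 <= t -> `|V t| <= N * t `^ p.
Proof.
move=> Fsign; exists (v0 / t0 `^ p + 2 * C) => t t0t.
have t0p : 0 < t0 `^ p by rewrite powR_gt0.
suff h : `|V t| <= v0 + 2 * C * t `^ p.
  rewrite (le_trans h)// [leRHS]mulrDl lerD2r mulrAC ler_pdivlMr// ler_wpM2l//.
  by rewrite powR_le_base// ltW.
have Vt0 : V t0 = v0.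
  by rewrite hV// set_itv1 Rintegral_set1 !subrr addr0 subr0.
rewrite ler_norml lerNl; apply/andP; split.
- apply: (@one_sided (fun s => - V s) (fun s => - b s)
    (fun s => - (s `^ (- beta) * F (V s)))) => //.
  + by move=> s; apply: cvgN; exact: cV.
  + by move=> s; apply: cvgN; exact: integrand_continuous.
  + by rewrite Vt0 (le_trans _ v00)// oppr_le0.
  + by move=> s _; rewrite normrN.
  + move=> s ts _; rewrite oppr_gt0 => Vs.
    by rewrite -mulrN mulr_ge0 ?powR_ge0// oppr_ge0 -(nmulr_rge0 _ Vs).
  + move=> s ts st; rewrite Vt0 [in LHS]hV//.
    under [X in _ = _ - X]eq_Rintegral do rewrite -mulN1r.
    rewrite RintegralZl//; last exact/segment_integrable/integrand_continuous.
    by ring.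
- apply: (@one_sided V b (fun s => s `^ (- beta) * F (V s))) => //.
  + exact: integrand_continuous.
  + by rewrite Vt0.
  + by move=> s ts _ Vs; rewrite mulr_ge0 ?powR_ge0// -(pmulr_rge0 _ Vs).
  + by move=> s ts st; rewrite Vt0 hV.
Qed.

(** The best constant [N] on a segment satisfies [N <= A + A' * N `^ gamma], with
    [A] and [A'] independent of the segment; as [gamma < 1], this bounds [N]. *)
Let growth_sublinear : gamma < 1 ->
  exists N, forall t, t0 <= t -> `|V t| <= N * t `^ p.
Proof.
move=> gamma1.
have t0p : 0 < t0 `^ p by rewrite powR_gt0.
pose A := v0 / t0 `^ p + 2 * C.
pose A' := K * (t0 `^ (gamma * p - beta - (r - 1)) / r) * t0 `^ (r - p).
have A0 : 0 <= A by rewrite /A addr_ge0 ?mulr_ge0 ?invr_ge0 ?(ltW t0p).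
have A'0 : 0 <= A' by rewrite /A' !mulr_ge0 ?invr_ge0 ?powR_ge0 ?(ltW r0).
exists (1 + (A + A') `^ (1 - gamma)^-1) => t t0t.
have c1 : {within `[t0, t], continuous (fun s => `|V s| * s `^ (- p))}.
  apply/subspace_continuousP => s; rewrite /= in_itv/= => /andP[ts st].
  apply: cvgM; last first.
    by apply: cvg_within_filter; apply: powR_continuous; exact: pos.
  apply: cvg_norm.
  have /subspace_continuousP cs := within_ray_sub (b := t) (lexx t0) cV.
  by apply: cs; rewrite /= in_itv/= ts.
have [s] := EVT_max t0t c1; rewrite in_itv/= => /andP[ts st] smax.
set N := `|V s| * s `^ (- p) in smax.
have s0 := pos ts.
have N0 : 0 <= N by rewrite mulr_ge0 ?powR_ge0.
have VN x : t0 <= x <= t -> `|V x| <= N * x `^ p.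
  move=> /andP[tx xt]; have := smax x; rewrite in_itv/= tx xt => /(_ isT).
  by rewrite powRN ler_pdivrMr ?powR_gt0// pos.
have VsN : `|V s| = N * s `^ p.
  by rewrite /N powRN -mulrA mulVf ?mulr1// gt_eqF// powR_gt0.
have sp : 0 < s `^ p by rewrite powR_gt0.
have NA : N <= A + A' * N `^ gamma.
  rewrite -(ler_pM2r sp) -VsN hV//.
  have D : `|drift s| <= A' * N `^ gamma * s `^ p.
    rewrite (le_trans (drift_le ts N0 _))//.
      by move=> x /andP[tx xs]; apply: VN; rewrite tx (le_trans xs).
    rewrite [leRHS](_ : _ = K * N `^ gamma *
      (t0 `^ (gamma * p - beta - (r - 1)) / r) * (t0 `^ (r - p) * s `^ p)); last first.
      by rewrite /A'; ring.
    rewrite ler_wpM2l ?mulr_ge0 ?invr_ge0 ?powR_ge0 ?(ltW r0)//.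
    rewrite -{1}(subrK p r) (powRDpos _ _ s0) ler_wpM2r ?powR_ge0//.
    by rewrite powR_ge_base// subr_le0.
  have h1 : v0 <= v0 / t0 `^ p * s `^ p.
    by rewrite mulrAC ler_pdivlMr// ler_wpM2l// powR_le_base// ltW.
  have h2 := bC ts.
  have h3 := bC2 (lexx t0) ts.
  rewrite [leRHS]mulrDl /A [X in _ <= X + _]mulrDl.
  apply: (le_trans (ler_normB _ _)); rewrite -/(drift s).
  have := ler_normD v0 (b s - b t0); have := ler_normB (b s) (b t0).
  by rewrite (ger0_norm v00); lra.
have NN : N <= 1 + (A + A') `^ (1 - gamma)^-1.
  have [N1|N1] := leP N 1; first by rewrite (le_trans N1)// lerDl powR_ge0.
  have Np : 0 < N by exact: lt_trans N1.
  have gN : 1 <= N `^ gamma by have := powR_le_base ltr01 (ltW N1) gamma0; rewrite powR1.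
  have : N `^ (1 - gamma) <= A + A'.
    rewrite (powRDpos 1 (- gamma) Np) powRN powRr1 ?N0// ler_pdivrMr ?powR_gt0//.
    rewrite (le_trans NA)// mulrDl lerD2r ler_peMr//.
  have g1 : 0 < 1 - gamma by lra.
  move=> h; have : (N `^ (1 - gamma)) `^ (1 - gamma)^-1 <= (A + A') `^ (1 - gamma)^-1.
    have g1' : 0 <= (1 - gamma)^-1 by rewrite invr_ge0 ltW.
    by apply: (ge0_ler_powR g1') => //; rewrite nnegrE; [exact: powR_ge0|exact: addr_ge0].
  rewrite -powRrM divff ?gt_eqF// powRr1// => h'.
  by rewrite (le_trans h')// lerDr.
by rewrite (le_trans (VN t _)) ?t0t ?lexx// ler_wpM2r ?powR_ge0.
Qed.

(** The solution inherits the growth of the noise, hence the drift is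
    negligible. For [gamma >= 1] growth could only come from a repelling drift,
    which the sign condition excludes. *)
Lemma solution_noise_close : (1 <= gamma -> forall v, 0 <= v * F v) ->
  exists A, 0 <= A /\ forall t, t0 <= t -> `|V t - b t| <= A * t `^ r.
Proof.
move=> Fsign.
have [N VN] : exists N, forall t, t0 <= t -> `|V t| <= N * t `^ p.
  by have [/growth_sublinear//|/Fsign/growth_confining] := ltP gamma 1.
have N0 : 0 <= N.
  have := le_trans (normr_ge0 _) (VN t0 (lexx t0)).
  by rewrite pmulr_lge0// powR_gt0.
have t0r : 0 < t0 `^ r by rewrite powR_gt0.
exists ((v0 + `|b t0|) / t0 `^ r + K * N `^ gamma *
  (t0 `^ (gamma * p - beta - (r - 1)) / r)); split.
  by rewrite addr_ge0 ?divr_ge0 ?addr_ge0 ?mulr_ge0 ?invr_ge0 ?powR_ge0// ltW.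
move=> t t0t; rewrite hV//.
have D := drift_le t0t N0 (fun s h => VN s (andP h).1).
have h1 : v0 + `|b t0| <= (v0 + `|b t0|) / t0 `^ r * t `^ r.
  by rewrite mulrAC ler_pdivlMr// ler_wpM2l ?addr_ge0// powR_le_base// ltW.
rewrite [leRHS]mulrDl -/(drift t) (_ : _ - b t = (v0 - b t0) - drift t); last by ring.
apply: (le_trans (ler_normB _ _)); have := ler_normB v0 (b t0).
by rewrite (ger0_norm v00); lra.
Qed.

End drift.

(** * Comparison of the rescaled paths *)

Section rescaled_comparison.
Context {R : realType}.
Notation mu := (@lebesgue_measure R).

Lemma Rintegral_dilation (b : R -> R) (eps t : R) :
  {within `[0, +oo[, continuous b} -> 0 < eps -> 0 <= t ->
  \int[mu]_(s in `[0, t / eps]) b s = eps^-1 * \int[mu]_(s in `[0, t]) b (s / eps).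
Proof.
move=> cb e0 t0.
pose D (s : R) := s / eps.
have derD (s : R) : is_derive s (1 : R) D eps^-1.
  have -> : D = (eps^-1 *: (@id R)) by apply/funext => u; rewrite /D mulrC.
  by apply: is_derive_eq; rewrite /GRing.scale/= mulr1.
have D1 : (D^`())%classic = cst eps^-1.
  by apply/funext => s; rewrite derive1E; apply: derive_val.
have cD : continuous D.
  by move=> s; apply: cvgM; [exact: cvg_id|exact: cvg_cst].
have sub := @integration_by_substitution_increasing R D b 0 t t0.
have cbD : {within `[0, t], continuous (b \o D)}.
  exact: within_ray_sub (dilation_continuous e0 cb).
rewrite -RintegralZl//; last exact: segment_integrable cbD.
have D0 : D 0 = 0 by rewrite /D mul0r.
rewrite /Rintegral -{1}D0 -/(D t); congr fine.
rewrite sub.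
- by apply: eq_integral => s _; rewrite D1/= mulrC.
- by move=> x y _ _ xy; rewrite /D ltr_pM2r ?invr_gt0.
- by rewrite D1 => s _; exact: cvg_cst.
- by rewrite D1; exact: is_cvg_cst.
- by rewrite D1; exact: is_cvg_cst.
- split.
  + by move=> s _; apply: ex_derive.
  + by apply: cvg_at_right_filter; exact: cD.
  + by apply: cvg_at_left_filter; exact: cD.
- by rewrite D0; exact: within_ray_sub cb.
Qed.

Context (t0 x0 r A : R) (V X b : R -> R).
Context (t00 : 0 < t0) (r0 : 0 < r) (r2 : r < 2^-1) (A0 : 0 <= A)
  (cV : {within `[t0, +oo[, continuous V})
  (cX : {within `[t0, +oo[, continuous X})
  (cb : {within `[0, +oo[, continuous b})
  (hX : forall t, t0 <= t -> X t = x0 + \int[mu]_(s in `[t0, t]) V s)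
  (Vb : forall t, t0 <= t -> `|V t - b t| <= A * t `^ r).

Let N1 N : R := N.+1%:R.

Let near_times N : \forall eps \near 0^'+, forall t,
  (N1 N)^-1 <= t <= N1 N -> t0 <= t / eps.
Proof.
have n0 : 0 < N1 N by rewrite /N1 ltr0n.
near=> eps => t /andP[t1 _].
have e0 : 0 < eps by near: eps; exact: nbhs_right_gt.
rewrite ler_pdivlMr//; apply: le_trans t1.
rewrite -[leRHS]mul1r ler_pdivlMr// mulrAC mulrC -ler_pdivlMr ?mulr_gt0// div1r ltW//.
by near: eps; apply: nbhs_right_lt; rewrite invr_gt0 mulr_gt0.
Unshelve. all: by end_near. Qed.

Let small_times (eps t : R) N : 0 < eps -> (N1 N)^-1 <= t <= N1 N ->
  Num.sqrt eps * (A * (t / eps) `^ r) <= eps `^ (2^-1 - r) * (A * N1 N `^ r).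
Proof.
move=> e0 /andP[t1 t2].
have n0 : 0 < (N1 N)^-1 by rewrite invr_gt0 /N1 ltr0n.
have tp : 0 < t by exact: lt_le_trans t1.
have -> : Num.sqrt eps * (A * (t / eps) `^ r) = eps `^ (2^-1 - r) * (A * t `^ r).
  rewrite powRM ?invr_ge0 ?ltW// (powRDpos 2^-1 (- r) e0) powRN powR12_sqrt ?ltW//.
  by rewrite -(powR_inv1 (ltW e0)) -powRrM mulN1r powRN; ring.
by rewrite ler_wpM2l ?powR_ge0// ler_wpM2l// powR_le_base// ltW.
Qed.

Lemma rescaled_velocity_close N (e : R) : 0 < e -> \forall eps \near 0^'+,
  forall t, N.+1%:R^-1 <= t <= N.+1%:R ->
    `|rescaled (Num.sqrt eps) eps cV t - Num.sqrt eps * b (t / eps)| <= e.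
Proof.
move=> ep; have c0 : 0 <= A * N1 N `^ r by rewrite mulr_ge0 ?powR_ge0.
near=> eps => t tN.
have e0 : 0 < eps by near: eps; exact: nbhs_right_gt.
have tt : t0 <= t / eps by move: t tN; near: eps; exact: near_times.
rewrite /= (max_idPr tt) -mulrBr normrM ger0_norm ?sqrtr_ge0//.
apply: (le_trans (ler_wpM2l (sqrtr_ge0 _) (Vb tt))).
apply: (le_trans (small_times e0 tN)).
have : eps `^ (2^-1 - r) < e / (A * N1 N `^ r + 1).
  near: eps; have r2' : 0 < 2^-1 - r by rewrite subr_gt0.
  have /cvgr_lt := powR_cvg0 r2'; apply.
  by rewrite divr_gt0// ltr_wpDl.
rewrite ltr_pdivlMr ?ltr_wpDl// => h.
have := powR_ge0 eps (2^-1 - r); lra.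
Unshelve. all: by end_near. Qed.

Lemma rescaled_position_close N (e : R) : 0 < e -> \forall eps \near 0^'+,
  forall t, N.+1%:R^-1 <= t <= N.+1%:R ->
    `|rescaled (eps `^ (3 / 2)) eps cX t -
      \int[mu]_(s in `[0, t]) (Num.sqrt eps * b (s / eps))| <= e.
Proof.
move=> ep; set c := N1 N * (A * N1 N `^ r).
have n0 : 0 < N1 N by rewrite /N1 ltr0n.
have c0 : 0 <= c by rewrite !mulr_ge0 ?powR_ge0// ltW.
pose k := `|x0 - \int[mu]_(s in `[0, t0]) b s|.
have k0 : 0 <= k by exact: normr_ge0.
near=> eps => t tN.
have e0 : 0 < eps by near: eps; exact: nbhs_right_gt.
have e1 : eps <= 1 by near: eps; exact: nbhs_right_le.
have tt : t0 <= t / eps by move: t tN; near: eps; exact: near_times.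
have tp : 0 < t by have /andP[t1 _] := tN; apply: lt_le_trans t1; rewrite invr_gt0.
have tN1 : t <= N1 N by have /andP[] := tN.
have cu a : {within `[0, a], continuous b} by exact: within_ray_sub cb.
rewrite /= (max_idPr tt) hX//.
have cbe : {within `[0, t], continuous (fun s => b (s / eps))}.
  exact: within_ray_sub (dilation_continuous e0 cb).
rewrite RintegralZl//; last exact: segment_integrable.
have /(congr1 ( *%R eps)) := Rintegral_dilation cb e0 (ltW tp).
rewrite mulVKf ?gt_eqF// => <-.
rewrite (Rintegral_split (ltW t00) tt (cu _)).
have -> : eps `^ (3 / 2) = eps * Num.sqrt eps.
  rewrite (_ : 3 / 2 = 1 + 2^-1); last by field.
  by rewrite powRDpos// powRr1 ?ltW// powR12_sqrt// ltW.
set IV := \int[mu]_(s in `[t0, t / eps]) V s.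
set Ib := \int[mu]_(s in `[t0, t / eps]) b s.
set I0 := \int[mu]_(s in `[0, t0]) b s.
have hI : `|IV - Ib| <= A * (t / eps) `^ r * (t / eps).
  have Vbu s : t0 <= s <= t / eps -> `|V s - b s| <= A * (t / eps) `^ r.
    move=> /andP[ts st]; rewrite (le_trans (Vb ts))// ler_wpM2l// powR_le_base ?(ltW r0)//.
    exact: lt_le_trans ts.
  apply: le_trans (Rintegral_dist_le tt (within_ray_sub (lexx t0) cV)
    (within_ray_sub (ltW t00) cb) Vbu) _.
  by apply: ler_wpM2l; [rewrite mulr_ge0 ?powR_ge0|rewrite lerBlDr lerDl ltW].
rewrite (_ : _ - _ = eps * Num.sqrt eps * (x0 - I0) + eps * Num.sqrt eps * (IV - Ib)); last by ring.
apply: (le_trans (ler_normD _ _)); rewrite !normrM !(ger0_norm (sqrtr_ge0 _)) (gtr0_norm e0) -/k.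
have s1 : Num.sqrt eps <= 1 by rewrite -sqrtr1 ler_wsqrtr.
have s0 := sqrtr_ge0 eps.
have b1 : eps * Num.sqrt eps * k <= e / 2.
  have : eps < e / 2 / (k + 1).
    by near: eps; apply: nbhs_right_lt; rewrite !divr_gt0// ltr_wpDl.
  rewrite ltr_pdivlMr ?ltr_wpDl// => h.
  apply: (@le_trans _ _ (eps * k)); last by nra.
  by rewrite ler_wpM2r// ler_piMr// ltW.
have b2 : eps * Num.sqrt eps * `|IV - Ib| <= e / 2.
  apply: (@le_trans _ _ (eps * Num.sqrt eps * (A * (t / eps) `^ r * (t / eps)))).
    by rewrite ler_wpM2l// mulr_ge0// ltW.
  rewrite [leLHS](_ : _ = t * (Num.sqrt eps * (A * (t / eps) `^ r))); last first.
    by move: (_ `^ r) => q; field; rewrite gt_eqF.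
  apply: (@le_trans _ _ (eps `^ (2^-1 - r) * c)).
    rewrite /c [leRHS]mulrCA; apply: ler_pM => //.
    - exact: ltW.
    - by rewrite !mulr_ge0 ?powR_ge0.
    - exact: small_times.
  have : eps `^ (2^-1 - r) < e / 2 / (c + 1).
    near: eps; have r2' : 0 < 2^-1 - r by rewrite subr_gt0.
    have /cvgr_lt := powR_cvg0 r2'; apply.
    by rewrite !divr_gt0// ltr_wpDl.
  rewrite ltr_pdivlMr ?ltr_wpDl// => h.
  by have := powR_ge0 eps (2^-1 - r); lra.
by lra.
Unshelve. all: by end_near. Qed.

End rescaled_comparison.

(** * Merging in law *)

Section path_pairs.
Context {R : realType}.
Notation path2 := (cpath R * cpath R)%type.
Implicit Types (x y z : path2) (Phi : path2 -> R).

Definition path_dist x y : R := d_u x.1 y.1 + d_u x.2 y.2.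

Lemma d_u_ge0 (f g : cpath R) : 0 <= d_u f g.
Proof. by have := d_u_triangle f g f; rewrite d_uxx (d_uC g f); lra. Qed.

Lemma path_dist_ge0 x y : 0 <= path_dist x y.
Proof. by rewrite addr_ge0 ?d_u_ge0. Qed.

Lemma path_distxx x : path_dist x x = 0.
Proof. by rewrite /path_dist !d_uxx addr0. Qed.

Lemma path_distC x y : path_dist x y = path_dist y x.
Proof. by rewrite /path_dist d_uC (d_uC x.2). Qed.

Lemma path_dist_triangle x y z : path_dist x z <= path_dist x y + path_dist y z.
Proof.
apply: (le_trans (lerD (d_u_triangle x.1 y.1 z.1) (d_u_triangle x.2 y.2 z.2))).
by rewrite addrACA.
Qed.

Lemma continuous_path_dist Phi x (e : R) : continuous Phi -> 0 < e ->
  exists2 d, 0 < d & forall y, path_dist x y < d -> `|Phi x - Phi y| < e.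
Proof.
move=> cPhi e0; have /cvgrPdist_lt/(_ e e0) := cPhi x.
move=> /nbhs_ballP[d /= d0 hd]; exists d => // y xy; apply: hd.
have h1 := d_u_ge0 x.1 y.1; have h2 := d_u_ge0 x.2 y.2.
by move: xy; rewrite /path_dist => xy; split; rewrite cpath_ballE/=; lra.
Qed.

Lemma lipschitz_path_continuous Phi (m : R) : 0 <= m ->
  (forall x y, `|Phi x - Phi y| <= m * path_dist x y) -> continuous Phi.
Proof.
move=> m0 lip x; apply/cvgrPdist_lt => e e0.
have d0 : 0 < e / (m + 1) / 2 by rewrite !divr_gt0// ltr_wpDl.
apply: filterS (nbhsx_ballx x _ d0) => y [/=]; rewrite !cpath_ballE/= => h1 h2.
apply: (le_lt_trans (lip x y)); rewrite /path_dist.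
have : d_u x.1 y.1 + d_u x.2 y.2 < e / (m + 1) by lra.
rewrite ltr_pdivlMr ?ltr_wpDl//.
by have := d_u_ge0 x.1 y.1; have := d_u_ge0 x.2 y.2; nra.
Qed.

(** Lipschitz approximation of [Phi] from below (infimal convolution with a
    multiple of the distance). *)
Definition lip_below Phi (m : nat) x : R := inf [set Phi y + m%:R * path_dist x y | y in setT].

Section lip_below_theory.
Context (Phi : path2 -> R) (M : R) (PhiM : forall x, `|Phi x| <= M).

Let bound x m y : - M <= Phi y + m%:R * path_dist x y.
Proof.
have := PhiM y; rewrite ler_norml => /andP[h _].
by rewrite (le_trans h)// lerDl mulr_ge0// path_dist_ge0.
Qed.

Let has_lb m x : has_lbound [set Phi y + m%:R * path_dist x y | y in setT].
Proof. by exists (- M) => _ [y _ <-]; exact: bound. Qed.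

Lemma lip_below_le m x : lip_below Phi m x <= Phi x.
Proof.
apply: ge_inf; first exact: has_lb.
by exists x => //; rewrite path_distxx mulr0 addr0.
Qed.

Let le_lip_below m x (a : R) :
  (forall y, a <= Phi y + m%:R * path_dist x y) -> a <= lip_below Phi m x.
Proof.
move=> h; apply: lb_le_inf; last by move=> _ [y _ <-].
by exists (Phi x + m%:R * path_dist x x); exists x.
Qed.

Lemma lip_below_bound m x : `|lip_below Phi m x| <= M.
Proof.
rewrite ler_norml le_lip_below//= (le_trans (lip_below_le m x))//.
by have := PhiM x; rewrite ler_norml => /andP[].
Qed.

Lemma lip_below_lipschitz m x y :
  `|lip_below Phi m x - lip_below Phi m y| <= m%:R * path_dist x y.
Proof.
have half u v : lip_below Phi m u - m%:R * path_dist u v <= lip_below Phi m v.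
  apply: le_lip_below => z.
  have : lip_below Phi m u <= Phi z + m%:R * path_dist u z.
    by apply: ge_inf; [exact: has_lb|exists z].
  have : m%:R * path_dist u z <= m%:R * (path_dist u v + path_dist v z).
    by rewrite ler_wpM2l// path_dist_triangle.
  by rewrite mulrDr; lra.
have := half x y; have := half y x; rewrite (path_distC y x).
move: (lip_below Phi m x) (lip_below Phi m y) (m%:R * path_dist x y) => a b c h1 h2.
by rewrite ler_norml; apply/andP; split; lra.
Qed.

Lemma lip_below_continuous m : continuous (lip_below Phi m).
Proof. exact: lipschitz_path_continuous (lip_below_lipschitz m). Qed.

(** Points [y] close to [x] have [Phi y] close to [Phi x]; at the others the
    penalty [m%:R * path_dist x y] eventually exceeds [2 * M]. *)
Lemma lip_below_cvg x : continuous Phi -> lip_below Phi m x @[m --> \oo] --> Phi x.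
Proof.
move=> cPhi; apply/cvgrPdist_le => e e0.
have [d d0 hd] := continuous_path_dist x cPhi e0.
near=> m.
rewrite ger0_norm ?subr_ge0 ?lip_below_le// lerBlDr -lerBlDl.
apply: le_lip_below => y.
have [/hd|dy] := ltP (path_dist x y) d.
  rewrite ltr_norml => /andP[h1 h2].
  have : 0 <= m%:R * path_dist x y by rewrite mulr_ge0// path_dist_ge0.
  lra.
have : 2 * M / d <= m%:R by near: m; exact: nbhs_infty_ger.
rewrite ler_pdivrMr// => h.
have : m%:R * d <= m%:R * path_dist x y by rewrite ler_wpM2l.
have := PhiM x; have := PhiM y; rewrite !ler_norml => /andP[a1 a2] /andP[b1 b2]; lra.
Unshelve. all: by end_near. Qed.

End lip_below_theory.

Lemma bounded_expectationE d (T : measurableType d) (P : probability T R) (f : T -> R) (M : R) :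
  measurable_fun [set: T] f -> (forall w, `|f w| <= M) ->
  ('E_P[f] = (\int[P]_w f w)%R%:E)%E.
Proof.
move=> mf fM; rewrite unlock /Rintegral fineK//.
by apply: integrable_fin_num => //; exact: bounded_integrable fM.
Qed.

(** For a Lipschitz functional the difference of the expectations at [Z n] and
    [Y n] tends to zero by dominated convergence. As a continuous functional
    need not be uniformly continuous, it is first replaced by [lip_below]; this
    gives a lower bound for the limit, and the same bound for [- Phi] an upper
    one. *)
Lemma merging_law d (T : measurableType d) (P : probability T R)
    d' (T' : measurableType d') (P' : probability T' R)
    (Z Y : nat -> T -> path2) (L : T' -> path2) :
  (forall Phi (M : R), continuous Phi -> (forall x, `|Phi x| <= M) ->
     [/\ forall n, measurable_fun [set: T] (Phi \o Z n),
         forall n, measurable_fun [set: T] (Phi \o Y n),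
         measurable_fun [set: T'] (Phi \o L) &
         forall n, ('E_P[Phi \o Y n] = 'E_P'[Phi \o L])%E]) ->
  {ae P, forall w, path_dist (Z n w) (Y n w) @[n --> \oo] --> 0} ->
  forall Phi (M : R), continuous Phi -> (forall x, `|Phi x| <= M) ->
  ('E_P[Phi \o Z n] @[n --> \oo] --> 'E_P'[Phi \o L])%E.
Proof.
have arith (e x y u v : R) :
  x - e / 2 <= y -> u <= v -> - (e / 2) <= u - y -> x - e <= v by lra.
have arith' (e x y : R) : x - e <= y -> - x - e <= - y -> `|x - y| <= e.
  by move=> h1 h2; rewrite ler_norml; apply/andP; split; lra.
move=> hyp aeZY.
have lower Phi (M e : R) : continuous Phi -> (forall x, `|Phi x| <= M) -> 0 < e ->
    \forall n \near \oo, \int[P']_w Phi (L w) - e <= \int[P]_w Phi (Z n w).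
  move=> cPhi PhiM e0.
  have [mZ _ mL _] := hyp Phi M cPhi PhiM.
  have lipM m := lip_below_bound PhiM m.
  have hm m := hyp (lip_below Phi m) M (@lip_below_continuous Phi M PhiM m) (lipM m).
  have [m hmL] : exists m : nat, \int[P']_w Phi (L w) - e / 2 <= \int[P']_w lip_below Phi m (L w).
    have [] := @dominated_convergence _ T' R P' setT measurableT
      (fun m => EFin \o (lip_below Phi m \o L)) (EFin \o (Phi \o L)) (cst M%:E).
    - by move=> m; apply/measurable_EFinP; have [_ _ + _] := hm m.
    - exact/measurable_EFinP.
    - apply: aeW => w _; apply: cvg_EFin; first exact: nearW.
      exact: lip_below_cvg PhiM _ cPhi.
    - by apply: (@bounded_integrable _ _ _ _ (cst M) `|M|).
    - by apply: aeW => w m _; rewrite /= lee_fin.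
    move=> _ _ h.
    have h' : (\int[P']_w lip_below Phi m (L w)) @[m --> \oo] --> \int[P']_w Phi (L w).
      apply: (fine_cvg (a := \int[P']_w Phi (L w))).
      by rewrite -(bounded_expectationE P' mL (fun w => PhiM _)) unlock.
    move/cvgrPdist_le : h' => /(_ (e / 2) (divr_gt0 e0 (ltr0n R 2)))[m _ /(_ m (leqnn m))].
    by rewrite /= ler_norml => /andP[_ h']; exists m; lra.
  have [mmZ mmY mmL EY] := hm m.
  have diff : \int[P]_w (lip_below Phi m (Z n w) - lip_below Phi m (Y n w)) @[n --> \oo] --> 0.
    have [] := @dominated_convergence _ T R P setT measurableT
      (fun n w => (lip_below Phi m (Z n w) - lip_below Phi m (Y n w))%:E) (cst 0%E) (cst (M + M)%:E).
    - by move=> n; apply/measurable_EFinP; exact: (measurable_funB (mmZ n) (mmY n)).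
    - exact: measurable_cst.
    - apply: filterS aeZY => w hw _; apply: cvg_EFin; first by apply: nearW.
      apply/cvgr0Pnorm_le => eps eps0; near=> n.
      rewrite (le_trans (lip_below_lipschitz PhiM _ _ _))//.
      have : path_dist (Z n w) (Y n w) < eps / (m%:R + 1).
        near: n; move/cvgr_lt : hw; apply.
        by rewrite divr_gt0// ltr_wpDl.
      rewrite ltr_pdivlMr ?ltr_wpDl//.
      by have := path_dist_ge0 (Z n w) (Y n w); lra.
    - by apply: (@bounded_integrable _ _ _ _ (cst (M + M)) `|M + M|).
    - apply: aeW => w n _; rewrite /= lee_fin (le_trans (ler_normB _ _))//.
      by rewrite lerD.
    move=> _ _; rewrite integral0 => h.
    by apply: (fine_cvg (a := 0)); exact: h.
  have ibZ n := bounded_integrable P (mmZ n) (fun w => lipM m _).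
  have ibY n := bounded_integrable P (mmY n) (fun w => lipM m _).
  near=> n.
  have h1 : \int[P]_w lip_below Phi m (Z n w) <= \int[P]_w Phi (Z n w).
    apply: le_Rintegral => //; first exact: ibZ.
      exact: bounded_integrable (mZ n) (fun w => PhiM _).
    by move=> w _; exact: lip_below_le PhiM _ _.
  have h2 : - (e / 2) <= \int[P]_w (lip_below Phi m (Z n w) - lip_below Phi m (Y n w)).
    suff : `|\int[P]_w (lip_below Phi m (Z n w) - lip_below Phi m (Y n w))| <= e / 2.
      by rewrite ler_norml => /andP[].
    near: n; move/cvgr0Pnorm_le : diff; apply.
    by rewrite divr_gt0.
  have h3 : \int[P]_w lip_below Phi m (Y n w) = \int[P']_w lip_below Phi m (L w).
    apply: EFin_inj.
    rewrite -(bounded_expectationE P (mmY n) (fun w => lipM m _)).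
    by rewrite -(bounded_expectationE P' mmL (fun w => lipM m _)) EY.
  rewrite RintegralB// in h2; [|exact: ibZ|exact: ibY].
  by rewrite h3 in h2; exact: arith hmL h1 h2.
move=> Phi M cPhi PhiM.
have [mZ _ mL _] := hyp Phi M cPhi PhiM.
rewrite (bounded_expectationE P' mL (fun w => PhiM _)).
under eq_fun do rewrite (bounded_expectationE P (mZ _) (fun w => PhiM _)).
apply: cvg_EFin; first exact: nearW.
apply/cvgrPdist_le => e e0.
have cN : continuous (fun x => - Phi x) by move=> x; apply: cvgN; exact: cPhi.
have NM x : `|- Phi x| <= M by rewrite normrN.
have l1 := lower Phi M e cPhi PhiM e0.
have l2 := lower (fun x => - Phi x) M e cN NM e0.
near=> n.
have h1 : \int[P']_w Phi (L w) - e <= \int[P]_w Phi (Z n w) by near: n.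
have h2 : \int[P']_w (- Phi (L w)) - e <= \int[P]_w (- Phi (Z n w)) by near: n.
have oppE d0 (T0 : measurableType d0) (P0 : probability T0 R) (f : T0 -> R) :
    measurable_fun [set: T0] f -> (forall w, `|f w| <= M) ->
    \int[P0]_w (- f w) = - \int[P0]_w f w.
  move=> mf fM; rewrite -mulN1r -RintegralZl//; last exact: bounded_integrable fM.
  by apply: eq_Rintegral => w _; rewrite mulN1r.
rewrite (oppE _ _ _ _ mL (fun w => PhiM _)) (oppE _ _ _ _ (mZ n) (fun w => PhiM _)) in h2.
exact: arith' h1 h2.
Unshelve. all: by end_near. Qed.

End path_pairs.

(** * Convergence of the rescaled solution *)

Section main.
Context {R : realType}.

(** As [p] and [r] tend to [1/2], the last inequality becomes
    [beta >= (gamma + 1) / 2], which holds strictly. *)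
Lemma growth_exponents (gamma beta : R) : 0 <= gamma -> 2^-1 < beta / (gamma + 1) ->
  exists p r, [/\ 2^-1 < p, p < 1, 0 < r, r < 2^-1 & gamma * p - beta <= r - 1].
Proof.
move=> g0 hq; have g1 : 0 < gamma + 1 by lra.
rewrite ltr_pdivlMr// in hq.
pose eta := beta - (gamma + 1) / 2.
have eta0 : 0 < eta by rewrite /eta; lra.
pose x := eta / (2 * (gamma + 1)).
have x0 : 0 < x by rewrite divr_gt0// mulr_gt0.
have gx : gamma * Num.min 4^-1 x <= eta / 2.
  apply: (@le_trans _ _ ((gamma + 1) * x)); last first.
    rewrite [leLHS](_ : _ = eta / 2)// /x; field; rewrite gt_eqF//.
  by apply: ler_pM => //; rewrite ?le_min ?(ltW x0) ?ge_min ?lexx ?orbT//; lra.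
exists (2^-1 + Num.min 4^-1 x), (Num.max 4^-1 (2^-1 - eta / 2)); split.
- by rewrite ltrDl lt_min x0 andbT; lra.
- have : Num.min 4^-1 x <= 4^-1 by rewrite ge_min lexx.
  lra.
- by rewrite lt_max; apply/orP; left; lra.
- by rewrite gt_max; apply/andP; split; lra.
- have : 2^-1 - eta / 2 <= Num.max 4^-1 (2^-1 - eta / 2) by rewrite le_max lexx orbT.
  rewrite /eta in gx *; lra.
Qed.

Lemma cpath_eq (f g : cpath R) : path_fun f = path_fun g -> f = g.
Proof.
case: f g => [f cf] [g cg] /= fg; case: _ / fg in cg *.
by congr CPath; exact: Prop_irrelevance.
Qed.

Lemma rescaled_measurable d (T : measurableType d) (P : probability T R)
    (V : R -> {RV P >-> R}) (a t0 eps t : R) :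
  measurable_fun [set: T] (fun w => a * V (Num.max t0 (t / eps)) w).
Proof. by apply: measurable_funM => //; exact: measurable_funPT. Qed.

Lemma rescaled_functional_measurable d (T : measurableType d) (P : probability T R)
    (V X : R -> {RV P >-> R}) (t0 a a' eps : R)
    (cV : forall w, {within `[t0, +oo[, continuous (fun t => V t w)})
    (cX : forall w, {within `[t0, +oo[, continuous (fun t => X t w)})
    (Phi : cpath R * cpath R -> R) (M : R) :
  continuous Phi -> (forall s, `|Phi s| <= M) ->
  measurable_fun [set: T]
    (fun w => Phi (rescaled a eps (cV w), rescaled a' eps (cX w))).
Proof.
move=> cPhi PhiM.
have c (U : R -> {RV P >-> R}) (a0 : R)
    (cU : forall w, {within `[t0, +oo[, continuous (fun t => U t w)}) w :
    {within `[0, +oo[, continuous (fun t => a0 * U (Num.max t0 (t / eps)) w)}.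
  by apply: continuous_subspaceT; exact: rescaled_continuous (cU w).
have := @path_functional_measurable R d T
  (fun t w => a * V (Num.max t0 (t / eps)) w) (fun t w => a' * X (Num.max t0 (t / eps)) w)
  (c V a cV) (c X a' cX) P Phi M
  (fun t _ => rescaled_measurable V a t0 eps t)
  (fun t _ => rescaled_measurable X a' t0 eps t) cPhi PhiM.
congr (measurable_fun _ _); apply/funext => w.
by congr (Phi (_, _)); exact: cpath_eq.
Qed.

End main.

Theorem theorem2p2 (R : realType) (gamma beta : R) (F : R -> R)
  (t0 v0 x0 : R)
  (d : measure_display) (T : measurableType d) (P : probability T R)
  (B V X : R -> {RV P >-> R})
  (d' : measure_display) (T' : measurableType d') (P' : probability T' R)
  (W : R -> {RV P' >-> R})
  (hgamma : 0 <= gamma)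
  (hq : 2^-1 < beta / (gamma + 1))
  (hFcont : continuous F)
  (hF : pos_homogeneous gamma F \/
        exists G : R -> R, [/\ forall v, 0 <= G v, pos_homogeneous gamma G
                             & forall v, `|F v| <= G v])
  (hFsign : 1 <= gamma -> forall v, 0 <= v * F v)
  (ht0 : 0 < t0) (hv0 : 0 < v0)
  (hB : brownian_motion B)
  (hVX : strong_solution F beta t0 v0 x0 B V X)
  (hW : brownian_motion W) :
  cvg_in_distribution P
    (fun eps w =>
       (rescaled (Num.sqrt eps) eps (sol_continuousV hVX w),
        rescaled (eps `^ (3 / 2)) eps (sol_continuousX hVX w)))
    0^'+
    P'
    (fun w => (restricted (bm_continuous hW w), integrated (bm_continuous hW w))).
Proof.
move=> Phi cPhi [M PhiM].
have [p [r [p2 p1 r0 r2 pr]]] := growth_exponents hgamma hq.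
have [K [K0 FK]] : exists K, 0 <= K /\ forall v, `|F v| <= K * `|v| `^ gamma.
  case: hF => [/(pos_homogeneous_le hgamma)//|[G [_ /(pos_homogeneous_le hgamma)[K [K0 GK]] FG]]].
  exists K; split => // v; rewrite (le_trans (FG v))// (le_trans _ (GK v))//.
  exact: ler_norm.
pose Z (eps : R) w : cpath R * cpath R :=
  (rescaled (Num.sqrt eps) eps (sol_continuousV hVX w),
   rescaled (eps `^ (3 / 2)) eps (sol_continuousX hVX w)).
pose L w := (restricted (bm_continuous hW w), integrated (bm_continuous hW w)).
have mZ (Psi : cpath R * cpath R -> R) (N : R) : continuous Psi -> (forall x, `|Psi x| <= N) ->
    forall eps, measurable_fun [set: T] (Psi \o Z eps).
  by move=> cPsi PsiN eps; exact: rescaled_functional_measurable cPsi PsiN.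
have [mL _] := brownian_functional_limit hW cPhi PhiM.
suff seqlim (u : nat -> R) : (forall n, 0 < u n) -> u n @[n --> \oo] --> 0 ->
    ('E_P[Phi \o Z (u n)] @[n --> \oo] --> 'E_P'[Phi \o L])%E.
  have EL := bounded_expectationE P' mL (fun w => PhiM _).
  rewrite -/Z -/L [X in _ --> X]EL; apply/cvge_at_rightP => u [u0 ucvg].
  by have := seqlim u u0 ucvg; rewrite [X in _ --> X]EL.
move=> u0 ucvg.
have uright A : (nbhs 0^'+) A -> \forall n \near \oo, A (u n).
  move=> hA; have : \forall n \near \oo, 0 < u n -> A (u n) by exact: (ucvg _ hA).
  by apply: filterS => n; apply.
(* The rescaled noise is a Brownian motion for each [u n], hence has the law of [W]. *)
pose hBn n := brownian_motion_rescale (u0 n) hB.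
pose Y n w := (restricted (bm_continuous (hBn n) w), integrated (bm_continuous (hBn n) w)).
apply: (@merging_law R d T P d' T' P' (fun n => Z (u n)) Y L _ _ Phi M) => //.
  move=> Psi N cPsi PsiN; split.
  - by move=> n; exact: mZ PsiN _.
  - by move=> n; have [] := brownian_functional_limit (hBn n) cPsi PsiN.
  - by have [] := brownian_functional_limit hW cPsi PsiN.
  - by move=> n; exact: brownian_motion_law PsiN.
apply: filterS3 (brownian_growth hB ht0 p2 p1) (sol_V hVX) (sol_X hVX) => w [C BC] hV hX.
have p0 : 0 < p by rewrite (lt_trans _ p2).
have cV := sol_continuousV hVX w; have cX := sol_continuousX hVX w.
have [A [A0 VB]] := solution_noise_close hgamma ht0 (ltW hv0) p0 r0
  (ltW (lt_trans r2 p2)) pr K0 hFcont FK cV BC hV hFsign.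
have closeV N e e0 := uright _ (@rescaled_velocity_close R t0 r A (V ^~ w) (B ^~ w)
  ht0 r0 r2 A0 (sol_continuousV hVX w) VB N e e0).
have closeX N e e0 := uright _ (@rescaled_position_close R t0 x0 r A (V ^~ w) (X ^~ w) (B ^~ w)
  ht0 r0 r2 A0 cV (sol_continuousX hVX w) (bm_continuous hB w) hX VB N e e0).
have close1 := @d_u_cvg0 R nat \oo _ (fun n => (Z (u n) w).1) (fun n => (Y n w).1) closeV.
have close2 := @d_u_cvg0 R nat \oo _ (fun n => (Z (u n) w).2) (fun n => (Y n w).2) closeX.
apply/cvgr0Pnorm_lt => e e0.
have e2 : 0 < e / 2 by rewrite divr_gt0.
near=> n; rewrite ger0_norm ?path_dist_ge0// [ltRHS](splitr e) ltrD//.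
- by near: n; exact: close1.
- by near: n; exact: close2.
Unshelve. all: by end_near. Qed.
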